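(* Let $X$ be a compact Hausdorff space, $\delta$ a real line bundle over $X$ (with inner product), $\lambda$ a fixed $\mathbb{C}_\delta$-line bundle over $X$, and $\xi$ a $\mathbb{C}_\delta$-vector bundle over $X$. Then there is a natural correspondence, up to homotopy, between $\mathbb{H}_\lambda$-structures on $\xi$ (extending the given $\mathbb{C}_\delta$-structure) and non-singular skew-symmetric $\mathbb{C}_\delta$-bilinear forms $\xi\otimes_{\mathbb{C}_\delta}\xi\to\lambda$; that is, a natural bijection between homotopy classes of such $\mathbb{H}_\lambda$-structures and homotopy classes of such forms.
   Context: $\mathbb{C}_\delta=\mathbb{R}\oplus\delta$ is the bundle of algebras in which every unit-length element of $\delta_x$ is a square root of $-1$. A $\mathbb{C}_\delta$-vector bundle is a real vector bundle with a $\mathbb{C}_\delta$-module structure. A $\mathbb{C}_\delta$-line bundle $\lambda$ (real dimension $2$, with compatible inner product) has $\Lambda^2_{\mathbb{R}}\lambda=\delta$. For an oriented $3$-dimensional real vector bundle $\alpha$ with positive-definite inner product, $\mathbb{H}_\alpha$ is the bundle of quaternion algebras $\mathbb{R}1\oplus\alpha$ with multiplication $(s,u)\cdot(t,v)=(st-\langle u,v\rangle,\ sv+tu+u\times v)$; and $\mathbb{H}_\lambda:=\mathbb{H}_{\Lambda^2\lambda\oplus\lambda}=\mathbb{H}_{\delta\oplus\lambda}$, which contains $\mathbb{C}_\delta=\mathbb{R}\oplus\delta$ as a bundle of subalgebras. An $\mathbb{H}_\lambda$-structure on $\xi$ is a left $\mathbb{H}_\lambda$-module structure. Homotopies are through $\mathbb{H}_\lambda$-structures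 extending the given $\mathbb{C}_\delta$-structure, respectively through non-singular skew-symmetric $\mathbb{C}_\delta$-bilinear forms. *)

(* Defs.v *)
From HB Require Import structures.
From mathcomp Require Import all_boot all_order all_algebra.
From mathcomp Require Import all_classical all_reals all_analysis.
Import Order.TTheory GRing.Theory Num.Theory.
Import numFieldNormedType.Exports.

Set Implicit Arguments.
Unset Strict Implicit.
Unset Printing Implicit Defensive.

Local Open Scope classical_set_scope.
Local Open Scope ring_scope.

(* A family of types [A x] together with a topology on the disjoint union of
   the [A x], namely the one induced by the maps [fpt x : A x -> ftot].
   It serves to state the joint continuity of fibrewise maps: the fibre product
   of families carries the topology induced by the product of the [ftot]s. *)

Record fspace (X : choiceType) := FSpace {
  ffib :> X -> choiceType;
  ftot : topologicalType;
  fpt : forall x, ffib x -> ftot }.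

Definition total (X : choiceType) (A : fspace X) :=
  initial_topology (fun p : {x : X & A x} => fpt (tagged p)).

Definition fprod (X : choiceType) (A B : fspace X) : fspace X :=
  @FSpace X (fun x => (A x * B x)%type) (ftot A * ftot B)%type
    (fun x p => (fpt p.1, fpt p.2)).

(* X * T, as a family over X *)
Definition ftriv (X T : topologicalType) : fspace X :=
  @FSpace X (fun=> T) (X * T)%type (fun x t => (x, t)).

(* X * [0, 1], as a family over X *)
Definition fcyl (R : realType) (X : topologicalType) : fspace X :=
  @FSpace X (fun=> {t : R | 0 <= t <= 1}) (X * R)%type
    (fun x t => (x, val t)).

Definition bilinear (R : realType) (U V W : lmodType R) (f : U -> V -> W) :=
  (forall u, linear (f u)) /\ (forall v, linear (f ^~ v)).

(* [phi], [psi] restrict to inverse homeomorphisms between the part of the total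
   space lying over the open set U and U * R^n, over U and linear on fibres. *)
Definition trivialization (R : realType) (X : topologicalType)
    (F : X -> vectType R) (E : topologicalType) (pt : forall x, F x -> E)
    (proj : E -> X) (U : set X) (n : nat)
    (phi : E -> 'rV[R]_n) (psi : X * 'rV[R]_n -> E) : Prop :=
  [/\ open U,
      forall e, U (proj e) -> {for e, continuous phi}
        /\ psi (proj e, phi e) = e,
      forall y w, U y -> [/\ {for (y, w), continuous psi},
        proj (psi (y, w)) = y & phi (psi (y, w)) = w]
    & forall y, U y -> linear (fun v : F y => phi (pt y v))].

(* The fibres are abstract vector spaces; [vpt x] identifies [fibre x] with
   the fibre over x of the projection [vproj] of the total space. *)
Record vbundle (R : realType) (X : topologicalType) := VBundle {
  fibre :> X -> vectType R;
  vtot : topologicalType;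
  vpt : forall x, fibre x -> vtot;
  vproj : vtot -> X;
  vproj_continuous : continuous vproj;
  vptK : forall x (v : fibre x), vproj (vpt v) = x;
  vpt_inj : forall x, injective (@vpt x);
  vpt_surj : forall e, exists v : fibre (vproj e), vpt v = e;
  vbundle_locally_trivial : forall x, exists (U : set X) (n : nat)
    (phi : vtot -> 'rV[R]_n) (psi : X * 'rV[R]_n -> vtot),
    U x /\ trivialization vpt vproj U phi psi }.

Definition vfspace (R : realType) (X : topologicalType) (E : vbundle R X) :
    fspace X :=
  @FSpace X (fun x => E x : choiceType) (vtot E) (@vpt R X E).
Coercion vfspace : vbundle >-> fspace.

Record inner_product (R : realType) (X : topologicalType) (E : vbundle R X) :=
  InnerProduct {
  ip : forall x, E x -> E x -> R;
  ip_bilinear : forall x, bilinear (ip (x := x) : E x -> E x -> R^o);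
  ip_sym : forall x (u v : E x), ip u v = ip v u;
  ip_posdef : forall x (u : E x), u != 0 -> 0 < ip u u;
  ip_continuous : continuous (fun p : total (fprod E E) =>
    ip (tagged p).1 (tagged p).2) }.

Record rline (R : realType) (X : topologicalType) := RLine {
  rl_bundle :> vbundle R X;
  rl_dim : forall x, \dim {:rl_bundle x} = 1%N;
  rl_ip : inner_product rl_bundle }.

(* (s, u) . (t, v) = (s t - <u, v>, s v + t u + u >< v) *)
Definition qmul (R : realType) (V : lmodType R) (ipV : V -> V -> R)
    (cross : V -> V -> V) (a b : R^o * V) : R^o * V :=
  (a.1 * b.1 - ipV a.2 b.2,
   a.1 *: b.2 + b.1 *: a.2 + cross a.2 b.2).

Definition is_module (R : realType) (A E : lmodType R) (mul : A -> A -> A)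
    (one : A) (act : A -> E -> E) : Prop :=
  [/\ bilinear act, forall v, act one v = v
    & forall a b v, act (mul a b) v = act a (act b v)].

(* The fibres of C_delta = R (+) delta. *)
Definition Calg (R : realType) (X : topologicalType) (delta : rline R X)
    (x : X) : lmodType R := (R^o * delta x)%type.

Definition Cmul (R : realType) (X : topologicalType) (delta : rline R X)
    (x : X) : Calg delta x -> Calg delta x -> Calg delta x :=
  qmul (ip (rl_ip delta) (x := x)) (fun _ _ => 0).

Definition Cone (R : realType) (X : topologicalType) (delta : rline R X)
    (x : X) : Calg delta x := (1, 0).

Definition Cfspace (R : realType) (X : topologicalType) (delta : rline R X) :
  fspace X := fprod (ftriv X R) delta.

Record Cbundle (R : realType) (X : topologicalType) (delta : rline R X) :=
  CBundle {
  cb_bundle :> vbundle R X;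
  cact : forall x, Calg delta x -> cb_bundle x -> cb_bundle x;
  cact_module : forall x, is_module (@Cmul R X delta x) (Cone delta x)
    (cact (x := x));
  cact_continuous : continuous (fun p : total (fprod (Cfspace delta) cb_bundle) =>
    vpt (cact (tagged p).1 (tagged p).2) : vtot cb_bundle) }.

Definition dact (R : realType) (X : topologicalType) (delta : rline R X)
    (E : Cbundle delta) (x : X) (d : delta x) (v : E x) : E x :=
  cact ((0, d) : Calg delta x) v.

(* The inner product is compatible: unit vectors of delta act by isometries. *)
Record Cline (R : realType) (X : topologicalType) (delta : rline R X) :=
  CLine {
  cl_bundle :> Cbundle delta;
  cl_dim : forall x, \dim {:cl_bundle x} = 2%N;
  cl_ip : inner_product cl_bundle;
  cl_compat : forall x (d : delta x) (u v : cl_bundle x),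
    ip (rl_ip delta) d d = 1 -> ip cl_ip (dact d u) (dact d v) = ip cl_ip u v }.

Section Quaternions.
Variables (R : realType) (X : topologicalType) (delta : rline R X).
Variables (lambda : Cline delta) (x : X).

(* The identification of the exterior square of lambda with delta: if e in
   delta and u in lambda are unit vectors, then u /\ (e u) = e. *)
Definition wedge (u v : lambda x) : delta x :=
  xget 0 [set d | forall e, ip (rl_ip delta) d e = ip (cl_ip lambda) (dact e u) v].

(* delta (+) lambda, with the orthogonal sum inner product and the cross product
   of the orientation (e, u, e u), for unit vectors e in delta, u in lambda. *)
Definition dl : lmodType R := (delta x * lambda x)%type.

Definition dl_ip (a b : dl) : R :=
  ip (rl_ip delta) a.1 b.1 + ip (cl_ip lambda) a.2 b.2.

Definition dl_cross (a b : dl) : dl :=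
  (wedge a.2 b.2, dact a.1 b.2 - dact b.1 a.2).

(* The fibre of H_lambda = R (+) delta (+) lambda. *)
Definition Halg : lmodType R := (R^o * dl)%type.

Definition Hmul : Halg -> Halg -> Halg := qmul dl_ip dl_cross.

Definition Hone : Halg := (1, 0).

Definition C_in_H (z : Calg delta x) : Halg := (z.1, (z.2, 0)).

End Quaternions.

Definition Hfspace (R : realType) (X : topologicalType) (delta : rline R X)
    (lambda : Cline delta) : fspace X :=
  fprod (ftriv X R) (fprod delta lambda).

Lemma wedgeP (R : realType) (X : topologicalType) (delta : rline R X)
    (lambda : Cline delta) (x : X) (u v : lambda x) (e : delta x) :
  ip (rl_ip delta) (wedge u v) e = ip (cl_ip lambda) (dact e u) v.
Proof.
have ipDZl (E : vbundle R X) (g : inner_product E) a (p q r : E x) :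
    ip g (a *: p + q) r = a * ip g p r + ip g q r.
  by have [_ h] := ip_bilinear g x; apply: h.
have ip0l (E : vbundle R X) (g : inner_product E) (r : E x) : ip g 0 r = 0.
  by have := ipDZl E g (-1) 0 0 r; rewrite scaler0 addr0 mulN1r addNr.
have ipZl (E : vbundle R X) (g : inner_product E) a (p r : E x) :
    ip g (a *: p) r = a * ip g p r.
  by rewrite -[a *: p]addr0 ipDZl ip0l addr0.
have cactDZ a (p q : Calg delta x) : cact (a *: p + q) u
    = a *: cact p u + cact q u.
  by have [[_ h] _ _] := cact_module lambda x; apply: h.
have cact0 : cact (0 : Calg delta x) u = 0.
  have := cactDZ (-1) 0 0.
  by rewrite scaler0 addr0 scaleN1r addNr.
have dactZ a (d : delta x) : dact (a *: d) u = a *: dact d u.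
  have := cactDZ a (0, d) 0; rewrite addr0 cact0 addr0 => <-.
  by congr cact; congr pair; rewrite /= scaler0.
pose e0 : delta x := vpick fullv.
have e0N0 : e0 != 0 by rewrite vpick0 -dimv_eq0 rl_dim.
have spane0 d : exists c, d = c *: e0.
  apply/vlineP; suff -> : (<[e0]>)%VS = fullv by rewrite memvf.
  by apply/eqP; rewrite eqEdim subvf dim_vline e0N0 rl_dim.
have e0pos := ip_posdef (rl_ip delta) e0N0.
pose P := [set d | forall d', ip (rl_ip delta) d d'
                            = ip (cl_ip lambda) (dact d' u) v].
suff Pn0 : P !=set0 by have [d Pd] := Pn0; apply: (xgetPex 0 Pn0).
exists ((ip (cl_ip lambda) (dact e0 u) v / ip (rl_ip delta) e0 e0) *: e0) => d'.
have [c ->] := spane0 d'.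
rewrite dactZ !ipZl (ip_sym _ e0) ipZl.
by rewrite mulrCA -mulrA mulVf ?mulr1 // gt_eqF.
Qed.

Record Hstructure (R : realType) (X : topologicalType) (delta : rline R X)
    (lambda : Cline delta) (xi : Cbundle delta) := HStructure {
  hact :> forall x, Halg lambda x -> xi x -> xi x;
  hact_module : forall x, is_module (@Hmul R X delta lambda x)
    (Hone lambda x) (hact (x := x));
  hact_extends : forall x (z : Calg delta x) (v : xi x),
    hact (C_in_H lambda z) v = cact z v;
  hact_continuous : continuous (fun p : total (fprod (Hfspace lambda) xi) =>
    vpt (hact (tagged p).1 (tagged p).2) : vtot xi) }.

Definition Clinear (R : realType) (X : topologicalType) (delta : rline R X)
    (E F : Cbundle delta) (x : X) (f : E x -> F x) : Prop :=
  (forall u v, f (u + v) = f u + f v) /\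
  (forall (z : Calg delta x) u, f (cact z u) = cact z (f u)).

(* Non-singular skew-symmetric C_delta-bilinear forms on xi with values in
   lambda; non-singular means that the adjoint map from xi to
   Hom_{C_delta}(xi, lambda) is bijective. *)
Record skewform (R : realType) (X : topologicalType) (delta : rline R X)
    (lambda : Cline delta) (xi : Cbundle delta) := SkewForm {
  form :> forall x, xi x -> xi x -> lambda x;
  form_Clinear_r : forall x (u : xi x), Clinear (form u);
  form_Clinear_l : forall x (v : xi x), Clinear (fun u : xi x => form u v);
  form_skew : forall x (u v : xi x), form u v = - form v u;
  form_nonsingular : forall x (f : xi x -> lambda x), Clinear f ->
    exists! u : xi x, form u = f;
  form_continuous : continuous (fun p : total (fprod xi xi) =>
    vpt (form (tagged p).1 (tagged p).2) : vtot lambda) }.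

Definition Hhomotopic (R : realType) (X : topologicalType) (delta : rline R X)
    (lambda : Cline delta) (xi : Cbundle delta)
    (J0 J1 : Hstructure lambda xi) : Prop :=
  exists J : R -> Hstructure lambda xi, [/\ J 0 = J0, J 1 = J1 &
    continuous (fun p : total (fprod (fcyl R X) (fprod (Hfspace lambda) xi)) =>
      vpt (J (val (tagged p).1) _ (tagged p).2.1 (tagged p).2.2) : vtot xi)].

Definition form_homotopic (R : realType) (X : topologicalType)
    (delta : rline R X) (lambda : Cline delta) (xi : Cbundle delta)
    (w0 w1 : skewform lambda xi) : Prop :=
  exists w : R -> skewform lambda xi, [/\ w 0 = w0, w 1 = w1 &
    continuous (fun p : total (fprod (fcyl R X) (fprod xi xi)) =>
      vpt (w (val (tagged p).1) _ (tagged p).2.1 (tagged p).2.2)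
        : vtot lambda)].

Definition classes (T : Type) (r : T -> T -> Prop) :=
  {A : set T | exists a, A = [set b | r a b]}.

Definition class_of (T : Type) (r : T -> T -> Prop) (a : T) : classes r :=
  exist _ [set b | r a b] (ex_intro _ a erefl).

Definition Hclasses (R : realType) (X : topologicalType) (delta : rline R X)
    (lambda : Cline delta) (xi : Cbundle delta) : Type :=
  classes (@Hhomotopic R X delta lambda xi).

Definition form_classes (R : realType) (X : topologicalType)
    (delta : rline R X) (lambda : Cline delta) (xi : Cbundle delta) : Type :=
  classes (@form_homotopic R X delta lambda xi).

(* A bundle map over f that is an isomorphism on each fibre, i.e. an isomorphism
   of E' with the pull-back of E along f. *)

Record bmap (R : realType) (Y X : topologicalType) (f : Y -> X)
    (E' : vbundle R Y) (E : vbundle R X) := BMap {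
  bm :> forall y, E' y -> E (f y);
  bm_linear : forall y, linear (bm (y := y));
  bm_bij : forall y, bijective (bm (y := y));
  bm_continuous : continuous (fun p : total E' => vpt (bm (tagged p)) : vtot E) }.

(* Isomorphism of (delta', lambda', xi') with the pull-back of
   (delta, lambda, xi) along f. *)
Record data_map (R : realType) (Y X : topologicalType) (f : Y -> X)
    (delta' : rline R Y) (lambda' : Cline delta') (xi' : Cbundle delta')
    (delta : rline R X) (lambda : Cline delta) (xi : Cbundle delta) :=
  DataMap {
  dm_delta : bmap f delta' delta;
  dm_lambda : bmap f lambda' lambda;
  dm_xi : bmap f xi' xi;
  dm_delta_ip : forall y (d e : delta' y),
    ip (rl_ip delta) (dm_delta _ d) (dm_delta _ e) = ip (rl_ip delta') d e;
  dm_lambda_ip : forall y (u v : lambda' y),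
    ip (cl_ip lambda) (dm_lambda _ u) (dm_lambda _ v) = ip (cl_ip lambda') u v;
  dm_lambda_act : forall y (z : Calg delta' y) (u : lambda' y),
    dm_lambda _ (cact z u)
      = cact ((z.1, dm_delta _ z.2) : Calg delta (f y)) (dm_lambda _ u);
  dm_xi_act : forall y (z : Calg delta' y) (u : xi' y),
    dm_xi _ (cact z u)
      = cact ((z.1, dm_delta _ z.2) : Calg delta (f y)) (dm_xi _ u) }.

Section Pullback.
Variables (R : realType) (Y X : topologicalType) (f : Y -> X).
Variables (delta' : rline R Y) (lambda' : Cline delta') (xi' : Cbundle delta').
Variables (delta : rline R X) (lambda : Cline delta) (xi : Cbundle delta).
Variable m : data_map f lambda' xi' lambda xi.

Definition Hpullback (J : Hstructure lambda xi) (J' : Hstructure lambda' xi') :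
    Prop :=
  forall y (a : Halg lambda' y) (v : xi' y),
    dm_xi m _ (J' y a v)
      = J (f y) ((a.1, (dm_delta m _ a.2.1, dm_lambda m _ a.2.2))
                   : Halg lambda (f y)) (dm_xi m _ v).

Definition form_pullback (w : skewform lambda xi) (w' : skewform lambda' xi') :
    Prop :=
  forall y (u v : xi' y),
    dm_lambda m _ (w' y u v) = w (f y) (dm_xi m _ u) (dm_xi m _ v).

End Pullback.

(* Main.v *)
Require Import Defs.
From HB Require Import structures.
From mathcomp Require Import all_boot all_order all_algebra.
From mathcomp Require Import all_classical all_reals all_analysis.
From mathcomp Require Import complex ring lra.
Import Order.TTheory GRing.Theory Num.Theory.
Import numFieldNormedType.Exports.
Import VectorInternalTheory.
Set Implicit Arguments.
Unset Strict Implicit.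
Unset Printing Implicit Defensive.
Local Open Scope classical_set_scope.
Local Open Scope ring_scope.

(** Quaternionic structures and skew forms on xi determine each other once xi
    carries a metric q for which both delta and lambda act by skew operators.
    If J_u is the action of u in lambda, the equation
      <w(v, v'), u> = q(v, J_u v')      [is_form_of]
    defines a skew C_delta-bilinear form w with values in lambda; it is
    non-singular because J_u is invertible for u <> 0.

    Conversely, start from a form w and a metric g for which delta acts by skew
    operators, and define A_u by g(v, A_u v') = <w(v, v'), u>.  Then A_u is
    skew and C_delta-antilinear, depends C_delta-linearly on u, and -A_u^2 is
    positive.  By the conformality of u |-> A_u [conformal], the positive square
    root P of -A_u^2 / |u|^2 does not depend on u.  It commutes with every A_u,
    so J_u = P^-1 A_u is a quaternionic structure; it corresponds to w through
    the metric q = g(P -, -) [polar_J].  Thus every form comes, on the nose, from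
    a structure.

    The metric is an auxiliary choice from a convex set.  On a compact Hausdorff
    base metrics exist [metric_exists], and they can be averaged over delta and
    over lambda [herm_avg, quat_avg].  To pass to homotopy classes, let J_i and
    w_i correspond through q_i, for i = 0, 1.  Along a path J_t, average the
    segment (1-t) q_0 + t q_1 over J_t and read off the forms
    [corresponds_forms].  Along a path w_t, apply the construction of the
    preceding paragraph to the segment [corresponds_structures].  At both ends
    nothing changes, since q_i is already invariant under J_i: there the average
    is q_i and the square root is the identity.

    Continuity is tested along arbitrary filters, in local frames, where it
    becomes the convergence of matrix entries.  Everything is rational in these
    entries except the square root; its continuity [sqrt_fcont] follows from its
    uniqueness and from an a priori bound, by taking limits along ultrafilters.
    Naturality holds because metrics and forms can be pulled back. *)

(** * Inner products on real vector spaces *)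

Definition is_ip (R : realType) (V : lmodType R) (g : V -> V -> R) : Prop :=
  [/\ forall v, linear (g ^~ v : V -> R^o), forall u v, g u v = g v u
    & forall u, u != 0 -> 0 < g u u].

Section IpTheory.
Variables (R : realType) (V : lmodType R) (g : V -> V -> R).
Hypothesis ipg : is_ip g.

Lemma ip_sgC u v : g u v = g v u. Proof. by case: ipg. Qed.
Lemma ip_Dl u v w : g (u + v) w = g u w + g v w.
Proof. by case: ipg => + _ _ => /(_ w 1 u v); rewrite !scale1r. Qed.
Lemma ip_0l w : g 0 w = 0.
Proof. by apply: (@addrI _ (g 0 w)); rewrite -ip_Dl !addr0. Qed.
Lemma ip_Zl a v w : g (a *: v) w = a * g v w.
Proof. by case: ipg => + _ _ => /(_ w a v 0); rewrite !addr0 ip_0l addr0. Qed.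
Lemma ip_Nl v w : g (- v) w = - g v w.
Proof. by rewrite -scaleN1r ip_Zl mulN1r. Qed.
Lemma ip_Bl u v w : g (u - v) w = g u w - g v w.
Proof. by rewrite ip_Dl ip_Nl. Qed.
Lemma ip_Dr w u v : g w (u + v) = g w u + g w v.
Proof. by rewrite ip_sgC ip_Dl !(ip_sgC _ w). Qed.
Lemma ip_0r w : g w 0 = 0. Proof. by rewrite ip_sgC ip_0l. Qed.
Lemma ip_Zr a v w : g w (a *: v) = a * g w v.
Proof. by rewrite ip_sgC ip_Zl (ip_sgC w). Qed.
Lemma ip_Nr v w : g w (- v) = - g w v.
Proof. by rewrite ip_sgC ip_Nl (ip_sgC w). Qed.
Lemma ip_Br u v w : g w (u - v) = g w u - g w v.
Proof. by rewrite ip_Dr ip_Nr. Qed.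
Lemma ip_gt0 u : u != 0 -> 0 < g u u. Proof. by case: ipg => _ _; apply. Qed.
Lemma ip_ge0 u : 0 <= g u u.
Proof. by have [->|/ip_gt0/ltW//] := eqVneq u 0; rewrite ip_0l. Qed.
Lemma ip_eq0 u : g u u = 0 -> u = 0.
Proof. by move=> h; apply/eqP/negP => /negP/ip_gt0; rewrite h ltxx. Qed.
Lemma ip_inj u v : (forall w, g u w = g v w) -> u = v.
Proof.
move=> h; apply/eqP; rewrite -subr_eq0; apply/eqP/ip_eq0.
by rewrite ip_Bl h subrr.
Qed.
Lemma ip_injr u v : (forall w, g w u = g w v) -> u = v.
Proof. by move=> h; apply: ip_inj => w; rewrite !(ip_sgC _ w). Qed.
Lemma ip_suml I (r : seq I) (P : pred I) (F : I -> V) w :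
  g (\sum_(i <- r | P i) F i) w = \sum_(i <- r | P i) g (F i) w.
Proof.
elim/big_rec2 : _ => [|i y x _ <-]; first exact: ip_0l.
exact: ip_Dl.
Qed.

End IpTheory.

(** * Square roots of positive operators *)

Lemma interpolation (F : fieldType) (s : seq F) (f : F -> F) :
  exists p : {poly F}, forall x, x \in s -> p.[x] = f x.
Proof.
elim: s => [|x s [p hp]]; first by exists 0.
have [xs|xs] := boolP (x \in s).
  by exists p => y; rewrite inE => /orP[/eqP->|]; exact: hp.
pose q := \prod_(y <- s) ('X - y%:P).
have qx : q.[x] != 0 by rewrite -[_ == _]/(root q x) root_prod_XsubC.
exists (p + ((f x - p.[x]) / q.[x]) *: q) => y.
rewrite inE hornerD hornerZ => /orP[/eqP->|ys]; first by rewrite divfK // addrC subrK.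
have /eqP-> : root q y by rewrite root_prod_XsubC.
by rewrite mulr0 addr0 hp.
Qed.

Section Spectral.
Variables (R : realType) (n : nat) (g : 'rV[R]_n.+1 -> 'rV[R]_n.+1 -> R).
Hypothesis ipg : is_ip g.
Variable S : 'M[R]_n.+1.
Hypothesis selfadj : forall u v, g (u *m S) v = g u (v *m S).

(** Polynomials in a self-adjoint operator are self-adjoint. This is why the
    square root is sought among the polynomials in S: self-adjointness and
    commutation properties then come for free. *)
Lemma selfadj_horner (p : {poly R}) u v :
  g (u *m horner_mx S p) v = g u (v *m horner_mx S p).
Proof.
elim/poly_ind: p u v => [|p c ih] u v.
  by rewrite rmorph0 !mulmx0 (ip_0l ipg) (ip_0r ipg).
rewrite rmorphD rmorphM /= horner_mx_X horner_mx_C !mulmxDr.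
rewrite (ip_Dl ipg) (ip_Dr ipg) !mul_mx_scalar (ip_Zl ipg) (ip_Zr ipg).
congr (_ + _); rewrite -[_ * S]/(_ *m S) [in LHS]mulmxA selfadj ih.
by congr (g u _); rewrite -mulmxA (@comm_mx_horner _ _ S S p (comm_mx_refl S)).
Qed.

(** Write an eigenvector as a + i b with a, b real. Comparing g (a S) b with g
    a (b S) gives Im z * (g a a + g b b) = 0. *)
Lemma real_spectrum (z : R[i]) :
  eigenvalue (map_mx (real_complex R) S) z -> complex.Im z = 0.
Proof.
move=> /eigenvalueP [v vS v0].
pose a := map_mx (@complex.Re R) v; pose b := map_mx (@complex.Im R) v.
have entry k : (v *m map_mx (real_complex R) S) 0 k
    = ((a *m S) 0 k +i* (b *m S) 0 k)%C.
  rewrite !mxE (eq_bigr (fun j => ((a 0 j * S j k) +i* (b 0 j * S j k))%C)).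
    have : additive (fun t : R * R => (t.1 +i* t.2)%C : R[i]).
      by move=> [x1 x2] [y1 y2].
    elim/big_rec3: _ => [//|j x y w _ IH h].
    by rewrite (IH h).
  by move=> j _; rewrite !mxE; case: (v 0 j) => x y; simpc.
have aS : a *m S = complex.Re z *: a - complex.Im z *: b.
  apply/rowP => k; have := entry k; rewrite vS !mxE.
  by case: z {vS} => x y; case: (v 0 k) => p q /=; simpc => -[-> _].
have bS : b *m S = complex.Re z *: b + complex.Im z *: a.
  apply/rowP => k; have := entry k; rewrite vS !mxE.
  by case: z {vS aS} => x y; case: (v 0 k) => p q /=; simpc => -[_ ->].
have := selfadj a b; rewrite aS bS (ip_Bl ipg) (ip_Dr ipg) !(ip_Zl ipg) !(ip_Zr ipg).
move/eqP; rewrite -subr_eq0 opprD addrACA subrr add0r -opprD oppr_eq0 -mulrDr.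
rewrite mulf_eq0 => /orP[/eqP//|ab0]; case/eqP: v0.
have /andP[/eqP b0 /eqP a0] : (g b b == 0) && (g a a == 0).
  by rewrite -paddr_eq0 // ?(ip_ge0 ipg).
apply/rowP => k; rewrite mxE.
have := congr1 (fun w : 'rV[R]_n.+1 => w 0 k) (ip_eq0 ipg a0).
have := congr1 (fun w : 'rV[R]_n.+1 => w 0 k) (ip_eq0 ipg b0).
by rewrite !mxE; case: (v 0 k) => x y /= -> ->.
Qed.

Lemma char_poly_split : exists s : seq R, char_poly S = \prod_(x <- s) ('X - x%:P).
Proof.
have [s hs] := closed_field_poly_normal (char_poly (map_mx (real_complex R) S)).
move: hs; rewrite (monicP (char_poly_monic _)) scale1r => hs.
have sreal z : z \in s -> z = real_complex R (complex.Re z).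
  move=> zs; have : complex.Im z = 0.
    by apply: real_spectrum; rewrite eigenvalue_root_char hs root_prod_XsubC.
  by case: z {zs} => x y /= ->.
exists (map (@complex.Re R) s); apply: (map_poly_inj (real_complex R)).
rewrite map_char_poly hs rmorph_prod /= big_map.
apply: eq_big_seq => z /sreal hz.
by rewrite rmorphB /= map_polyX map_polyC /= -hz.
Qed.

(** A self-adjoint N with N^2 = 0 vanishes, since g (u N) (u N) = g (u N^2) u.
    Iterate on the powers N^(2^j). *)
Lemma nilpotent_selfadj (p : {poly R}) k :
  horner_mx S p ^+ k.+1 = 0 -> horner_mx S p = 0.
Proof.
move=> hk; have : horner_mx S p ^+ (2 ^ k.+1) = 0.
  have : (k.+1 <= 2 ^ k.+1)%N by apply/ltnW/ltn_expl.
  by move/subnK <-; rewrite exprD hk mulr0.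
elim: k.+1 => [|j ih]; first by rewrite expn0 expr1.
rewrite expnSr exprM -!rmorphXn /= => h2; apply: ih; rewrite -rmorphXn /=.
apply/row_matrixP => i; rewrite row0; apply: (ip_eq0 ipg).
rewrite rowE selfadj_horner -mulmxA.
move: h2; rewrite rmorphXn expr2 /= -[_ * _]/(_ *m _) => ->.
by rewrite mulmx0 (ip_0r ipg).
Qed.

Hypothesis pos : forall u, u != 0 -> 0 < g (u *m S) u.

(** The characteristic polynomial splits over the reals, so its squarefree
    part m vanishes at S, a power of m(S) being 0. Modulo m, a polynomial
    is known by its values on the positive eigenvalues, where h is made to
    interpolate the fourth root. The fourth root, rather than the square
    root, makes h(S)^2 visibly positive. *)
Lemma quartic_root : exists h : {poly R}, horner_mx S (h ^+ 4) = S.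
Proof.
have [s hs] := char_poly_split.
pose m : {poly R} := \prod_(x <- undup s) ('X - x%:P).
have dv : char_poly S %| m ^+ (size s).+1.
  have mx x : x \in s -> ('X - x%:P) %| m.
    by move=> xs; rewrite dvdp_XsubCl /m root_prod_XsubC mem_undup.
  rewrite hs exprS dvdp_mull //; elim: (s) mx => [|x t ih] mx.
    by rewrite big_nil expr0 dvdpp.
  rewrite big_cons exprS dvdp_mul ?mx ?mem_head // ih // => y yt.
  by rewrite mx // inE yt orbT.
have m0 : horner_mx S m = 0.
  apply: (@nilpotent_selfadj _ (size s)); rewrite -rmorphXn /=.
  by case/dvdpP : dv => q ->; rewrite rmorphM /= Cayley_Hamilton mulr0.
have spos x : x \in s -> 0 < x.
  move=> xs; have : eigenvalue S x by rewrite eigenvalue_root_char hs root_prod_XsubC.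
  move=> /eigenvalueP[v vS v0]; have := pos v0.
  by rewrite vS (ip_Zl ipg) pmulr_lgt0 // (ip_gt0 ipg).
have [h hh] := interpolation s (fun x => Num.sqrt (Num.sqrt x)).
exists h; apply/eqP; rewrite -subr_eq0 -{2}(horner_mx_X S) -rmorphB /=.
have : m %| h ^+ 4 - 'X.
  rewrite /m; apply: uniq_roots_dvdp; last by rewrite uniq_rootsE undup_uniq.
  apply/allP => x; rewrite mem_undup => xs.
  rewrite /root !hornerE hh // (exprM _ 2 2) !sqr_sqrtr ?subrr // ?sqrtr_ge0 //.
  exact/ltW/spos.
by case/dvdpP => q ->; rewrite rmorphM /= m0 mulr0.
Qed.

End Spectral.

Section FiniteDim.
Variables (R : realType) (V : vectType R) (g : V -> V -> R).
Hypothesis ipg : is_ip g.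

(** The map a |-> g a - is injective by definiteness, hence surjective by
    dimension. *)
Lemma riesz (f : V -> R^o) : linear f -> exists a, forall v, f v = g a v.
Proof.
move=> lf.
pose L (a : V) : 'rV[R]_(dim V) := \row_k g a (r2v (delta_mx 0 k)).
have linL : linear L.
  by move=> c a b; apply/rowP => k; rewrite !mxE (ip_Dl ipg) (ip_Zl ipg).
have sumE (h : V -> R^o) : linear h -> forall v,
    h v = \sum_k v2r v 0 k * h (r2v (delta_mx 0 k)).
  move=> lh v; pose hl := GRing.isLinear.Build _ _ _ _ h lh.
  pose hL : {linear V -> R^o} := HB.pack h hl.
  rewrite -[in LHS](v2rK v) [in LHS](row_sum_delta (v2r v)) linear_sum.
  rewrite -[h]/(hL : V -> R^o) linear_sum; apply: eq_bigr => k _.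
  by rewrite !linearZ.
have injL a : L a = 0 -> a = 0.
  move=> La; apply: (ip_eq0 ipg).
  rewrite (sumE (g a)) => [|c u v]; last by rewrite (ip_Dr ipg) (ip_Zr ipg).
  rewrite big1 // => k _; have := congr1 (fun w : 'rV[R]_(dim V) => w 0 k) La.
  by rewrite !mxE => ->; rewrite mulr0.
pose Lm := GRing.isLinear.Build _ _ _ _ L linL.
pose LL : {linear V -> 'rV[R]_(dim V)} := HB.pack L Lm.
have lk : lker (linfun LL) == 0%VS.
  apply/lker0P => a b; rewrite !lfunE => ab; apply: subr0_eq; apply: injL.
  by rewrite -[L _]/(LL (a - b)) linearB ab subrr.
have im : limg (linfun LL) = fullv.
  apply/eqP; rewrite eqEdim subvf /= (limg_dim_eq _) ?dimvf.
    by rewrite /dim /= mul1n.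
  by rewrite (eqP lk) capv0.
have : (\row_k f (r2v (delta_mx 0 k)) : 'rV[R]_(dim V)) \in limg (linfun LL).
  by rewrite im memvf.
case/memv_imgP => a _; rewrite lfunE /= => ha; exists a => v.
rewrite (sumE f lf) (sumE (g a)) => [|c u w]; last by rewrite (ip_Dr ipg) (ip_Zr ipg).
apply: eq_bigr => k _; congr (_ * _).
by have := congr1 (fun w : 'rV[R]_(dim V) => w 0 k) ha; rewrite !mxE.
Qed.

(** When b = g (S -) -, this says that P is the positive square root of S.
    Phrasing it with two forms lets continuity be stated for families of
    forms only. Only weak positivity is asked for, because it survives
    limits; strict positivity follows by uniqueness. *)
Definition is_sqrt (b : V -> V -> R) (P : V -> V) : Prop :=
  [/\ forall v w, g (P v) w = g v (P w), forall v, 0 <= g (P v) v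
    & forall v w, g (P v) (P w) = b v w].

(** In coordinates P = h(S)^2 with h(S)^4 = S. As a polynomial in S, it
    commutes with all that commutes with S. *)
Lemma sqrt_exists (b : V -> V -> R) : is_ip b ->
  exists P : V -> V, [/\ linear P, is_sqrt b P,
    forall v, v != 0 -> 0 < g (P v) v &
    forall T S : V -> V, linear T -> (forall v w, g (S v) w = b v w) ->
      (forall v, T (S v) = S (T v)) -> forall v, T (P v) = P (T v)].
Proof.
move=> ipb.
have Sex v : exists a, forall w, g a w = b v w.
  have [|a ha] := @riesz (b v); last by exists a.
  by move=> c u w; rewrite (ip_Dr ipb) (ip_Zr ipb).
pose S v := projT1 (cid (Sex v)).
have gS v w : g (S v) w = b v w by rewrite /S; case: (cid _).
have linS : linear S.
  move=> c u v; apply: (ip_inj ipg) => w.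
  by rewrite (ip_Dl ipg) (ip_Zl ipg) !gS (ip_Dl ipb) (ip_Zl ipb).
have [n [c [d [linc lind cd dc]]]] : exists n (c : V -> 'rV[R]_n) (d : 'rV[R]_n -> V),
    [/\ linear c, linear d, cancel c d & cancel d c].
  exists (dim V), v2r, r2v; split; [exact: linearP | exact: linearP | |].
    exact: v2rK.
  exact: r2vK.
have Suniq S' : (forall v w, g (S' v) w = b v w) -> S' = S.
  by move=> h; apply/funext => v; apply: (ip_inj ipg) => w; rewrite h gS.
case: n c d linc lind cd dc => [|n] c d linc lind cd dc.
  have triv (u v : V) : u = v.
    by rewrite -(cd u) -(cd v); congr d; rewrite !thinmx0.
  exists id; split=> //; last by move=> v; rewrite (triv v 0) eqxx.
  split=> // [v|v w]; first by rewrite (triv v 0) (ip_0l ipg).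
  by rewrite (triv v 0) (ip_0l ipg) (ip_0l ipb).
pose cl : {linear V -> 'rV[R]_n.+1} := HB.pack c (GRing.isLinear.Build _ _ _ _ c linc).
pose dl : {linear 'rV[R]_n.+1 -> V} := HB.pack d (GRing.isLinear.Build _ _ _ _ d lind).
pose mx (T : V -> V) (linT : linear T) : 'M[R]_n.+1 :=
  lin1_mx (cl \o (HB.pack T (GRing.isLinear.Build _ _ _ _ T linT) : {linear V -> V}) \o dl).
have mxE T (linT : linear T) v : c v *m mx T linT = c (T v).
  by rewrite /mx mul_rV_lin1 /= cd.
have mxd T (linT : linear T) r : r *m mx T linT = c (T (d r)).
  by rewrite -{1}(dc r) mxE.
pose g' u v := g (d u) (d v).
have ipg' : is_ip g'.
  split=> [v a u w|u v|u u0]; rewrite /g'.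
  - by rewrite -[d]/(dl : _ -> _) linearP (ip_Dl ipg) (ip_Zl ipg).
  - exact: (ip_sgC ipg).
  - apply: (ip_gt0 ipg); apply: contra_neq u0 => du.
    by rewrite -(dc u) du -[c]/(cl : _ -> _) linear0.
pose M := mx S linS.
have dM u : d (u *m M) = S (d u) by rewrite -{1}(dc u) mxE cd.
have sa u v : g' (u *m M) v = g' u (v *m M).
  by rewrite /g' !dM gS (ip_sgC ipg _ (S _)) gS (ip_sgC ipb).
have [|h hM] := @quartic_root _ _ g' ipg' M sa.
  move=> u u0; rewrite /g' dM gS; apply: (ip_gt0 ipb).
  by apply: contra_neq u0 => du; rewrite -(dc u) du -[c]/(cl : _ -> _) linear0.
pose H := horner_mx M h.
have PE : horner_mx M (h ^+ 2) = H *m H by rewrite rmorphXn expr2.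
pose Pm := horner_mx M (h ^+ 2).
have PP : Pm *m Pm = M.
  by rewrite -[RHS]hM (exprM h 2 2) [in RHS]rmorphXn /= expr2.
exists (fun v => d (c v *m Pm)).
have saP := selfadj_horner ipg' sa.
have posP v : v != 0 -> 0 < g (d (c v *m Pm)) v.
  move=> v0; have := saP h (c v *m H) (c v); rewrite -mulmxA -PE /g' cd => ->.
  apply: (ip_gt0 ipg); apply: contra_neq v0 => e0.
  have : S v = 0.
    have cH : c v *m H = 0.
      by rewrite -(dc (c v *m H)) e0 -[c]/(cl : _ -> _) linear0.
    rewrite -{1}(cd v) -dM -PP {1}/Pm PE !mulmxA cH !mul0mx.
    by rewrite -[d]/(dl : _ -> _) linear0.
  by move=> Sv; apply: (ip_eq0 ipb); rewrite -gS Sv (ip_0l ipg).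
split=> [a u v|||T S' linT gS' TS v] //.
- by rewrite linc mulmxDl -scalemxAl lind.
- split=> [v w|v|v w].
  + by have := saP (h ^+ 2) (c v) (c w); rewrite /g' !cd.
  + have [->|/posP/ltW//] := eqVneq v 0.
    by rewrite -[c]/(cl : _ -> _) linear0 mul0mx -[d]/(dl : _ -> _) linear0 (ip_0l ipg).
  + have := saP (h ^+ 2) (c v *m Pm) (c w); rewrite /g' cd => <-.
    by rewrite -mulmxA PP dM cd gS.
- rewrite (Suniq _ gS') in TS.
  have : comm_mx (mx T linT) M.
    by apply/row_matrixP => i; rewrite !rowE !mulmxA /M !mxd !cd TS.
  move/(comm_mx_horner (h ^+ 2)) => com.
  by rewrite -[LHS]cd -mxd -mulmxA -com mulmxA mxE.
Qed.

(** Any other root P' commutes with S = P'^2, hence with the root P that is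
    polynomial in S. So w = P v - P' v is killed by P + P', which is
    strictly positive. *)
Lemma sqrt_unique (b : V -> V -> R) P P' : is_ip b -> is_sqrt b P ->
  is_sqrt b P' -> P = P'.
Proof.
move=> ipb sP sP'.
suff key Q : is_sqrt b Q -> (forall v, v != 0 -> 0 < g (Q v) v) ->
    forall Q', is_sqrt b Q' -> (forall v, Q' (Q v) = Q (Q' v)) -> Q = Q'.
  have [Q [_ sQ pQ cQ]] := sqrt_exists ipb.
  suff h Q' : is_sqrt b Q' -> Q = Q' by rewrite -(h P) // -(h P').
  move=> sQ'; apply: key => // v; apply: (cQ _ (Q' \o Q')).
  - case: sQ' => sa _ _ c u w; apply: (ip_inj ipg) => z.
    by rewrite (ip_Dl ipg) (ip_Zl ipg) !sa (ip_Dl ipg) (ip_Zl ipg).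
  - by case: sQ' => sa _ h u w /=; rewrite sa h.
  - by [].
case=> sa _ hQ pQ Q' [sa' pQ' hQ'] com; apply/funext => v; apply/eqP.
rewrite -subr_eq0; apply/negP => /negP w0; have := pQ _ w0.
set w := Q v - Q' v => q1; have := ltr_wpDl (pQ' w) q1.
rewrite sa' sa -(ip_Dr ipg) {1}/w (ip_Bl ipg).
suff -> : g (Q v) (Q' w + Q w) = g (Q' v) (Q' w + Q w) by rewrite subrr ltxx.
rewrite !(ip_Dr ipg) hQ hQ' addrC; congr (_ + _).
by rewrite -sa' com sa.
Qed.

Lemma sqrt_linear (b : V -> V -> R) P : is_sqrt b P -> linear P.
Proof.
case=> sa _ _ c u v; apply: (ip_inj ipg) => w.
by rewrite (ip_Dl ipg) (ip_Zl ipg) !sa (ip_Dl ipg) (ip_Zl ipg).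
Qed.

Lemma sqrt_ip (b : V -> V -> R) P : is_ip b -> is_sqrt b P ->
  is_ip (fun v w => g (P v) w).
Proof.
move=> ipb sP; have [Q [linQ sQ pQ _]] := sqrt_exists ipb.
rewrite (sqrt_unique ipb sP sQ); case: sQ => sa _ _.
split=> // [v c u w|u v]; last by rewrite sa (ip_sgC ipg).
by rewrite linQ (ip_Dl ipg) (ip_Zl ipg).
Qed.

Lemma sqrt_comm (b : V -> V -> R) P T S : is_ip b -> is_sqrt b P -> linear T ->
  (forall v w, g (S v) w = b v w) -> (forall v, T (S v) = S (T v)) ->
  forall v, T (P v) = P (T v).
Proof.
move=> ipb sP; have [Q [_ sQ _ cQ]] := sqrt_exists ipb.
by rewrite (sqrt_unique ipb sP sQ); exact: cQ.
Qed.

End FiniteDim.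

(** * Convergence of matrices *)

(** A set that is not F-eventually hit by f has a complement compatible with
    F; an ultrafilter refining both would contradict the hypothesis. *)
Lemma cvg_ultra (I : Type) (T : topologicalType) (F : set_system I)
    (FF : Filter F) (f : I -> T) (l : T) :
  (forall U : set_system I, UltraFilter U -> F `<=` U -> f @ U --> l) ->
  f @ F --> l.
Proof.
move=> h W nW; apply: contrapT => nF.
have PG : ProperFilter (within (~` (f @^-1` W)) F).
  apply: Build_ProperFilter => h0; apply: nF.
  suff : F (f @^-1` W) by [].
  apply: (@filterS _ F FF _ _ _ h0) => i /= n.
  by apply: contrapT => m; apply: n.
have [U [UU sU]] := ultraFilterLemma PG.
have UP := @ultra_proper _ _ UU.
have FU : F `<=` U by move=> A FA; apply: sU; exact: (@cvg_within _ F FF).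
have UW : U (f @^-1` W) by exact: (h U UU FU W nW).
have UC : U (~` (f @^-1` W)) by apply: sU; exact: withinT.
have [i [Wi Ci]] := filter_ex (filterI UW UC).
exact: Ci.
Qed.

Lemma ultra_map (I T : Type) (U : set_system I) (f : I -> T) :
  UltraFilter U -> UltraFilter (f @ U).
Proof.
move=> UU; have UP := @ultra_proper _ _ UU; split=> [|G PG sG].
  exact: fmap_proper_filter.
apply/seteqP; split=> // A GA.
have [//|UC] := in_ultra_setVsetC (f @^-1` A) UU.
have GC : G (~` A) by exact: sG.
by have [y []] := filter_ex (filterI GA GC).
Qed.

Section MatrixCvg.
Variables (R : realType) (I : Type) (F : set_system I).
Context {FF : Filter F}.

Lemma mx_cvgP m n (M : I -> 'M[R]_(m, n)) (M0 : 'M[R]_(m, n)) :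
  M i @[i --> F] --> M0 <-> forall k l, M i k l @[i --> F] --> M0 k l.
Proof.
split=> [h k l|h].
  exact: (cvg_comp M (fun N : 'M[R]_(m, n) => N k l) h (@coord_continuous _ _ _ k l M0)).
move=> A [P nP sP].
have : F [set i | forall kl : 'I_m * 'I_n, P kl.1 kl.2 (M i kl.1 kl.2)].
  by apply: filter_forall => -[k' l'] /=; exact: (h k' l' _ (nP k' l')).
apply: (@filterS _ F FF) => i hi; apply: sP => k l.
exact: (hi (k, l)).
Qed.

Lemma cvg_sumr (J : Type) (r : seq J) (P : pred J) (f : J -> I -> R) (a : J -> R) :
  (forall j, P j -> f j i @[i --> F] --> a j) ->
  \sum_(j <- r | P j) f j i @[i --> F] --> \sum_(j <- r | P j) a j.
Proof. by move=> h; apply: cvg_big => //; exact: add_continuous. Qed.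

Lemma cvg_prodr (J : Type) (r : seq J) (P : pred J) (f : J -> I -> R) (a : J -> R) :
  (forall j, P j -> f j i @[i --> F] --> a j) ->
  \prod_(j <- r | P j) f j i @[i --> F] --> \prod_(j <- r | P j) a j.
Proof. by move=> h; apply: cvg_big => //; exact: mul_continuous. Qed.

Lemma cvg_mulmx m n p (A : I -> 'M[R]_(m, n)) (A0 : 'M[R]_(m, n))
    (B : I -> 'M[R]_(n, p)) (B0 : 'M[R]_(n, p)) :
  A i @[i --> F] --> A0 -> B i @[i --> F] --> B0 ->
  A i *m B i @[i --> F] --> A0 *m B0.
Proof.
move=> /mx_cvgP hA /mx_cvgP hB; apply/mx_cvgP => k l; rewrite mxE.
under eq_fun do rewrite mxE.
by apply: cvg_sumr => j _; apply: cvgM.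
Qed.

Lemma cvg_trmx m n (A : I -> 'M[R]_(m, n)) (A0 : 'M[R]_(m, n)) :
  A i @[i --> F] --> A0 -> (A i)^T @[i --> F] --> A0^T.
Proof.
move=> /mx_cvgP hA; apply/mx_cvgP => k l; rewrite mxE.
by under eq_fun do rewrite mxE; exact: hA.
Qed.

Lemma cvg_det n (A : I -> 'M[R]_n) (A0 : 'M[R]_n) :
  A i @[i --> F] --> A0 -> \det (A i) @[i --> F] --> \det A0.
Proof.
move=> /mx_cvgP hA; apply: cvg_sumr => s _.
by apply: cvgM; [exact: cvg_cst | exact: cvg_prodr].
Qed.

Lemma cvg_invmx n (A : I -> 'M[R]_n) (A0 : 'M[R]_n) : A0 \in unitmx ->
  A i @[i --> F] --> A0 -> invmx (A i) @[i --> F] --> invmx A0.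
Proof.
move=> uA hA; have dA := cvg_det hA.
have d0 : \det A0 != 0 by rewrite -unitfE -unitmxE.
have : (\det (A i))^-1 *: \adj (A i) @[i --> F] --> invmx A0.
  rewrite {1}/invmx uA; apply/mx_cvgP => k l; rewrite !mxE.
  under eq_fun do rewrite !mxE.
  apply: cvgM; first exact: cvgV.
  apply: cvgM; first exact: cvg_cst.
  apply: cvg_det; apply/mx_cvgP => a b; rewrite !mxE.
  by under eq_fun do rewrite !mxE; move/mx_cvgP: hA; apply.
apply: cvg_trans; apply: near_eq_cvg; near=> i.
rewrite /invmx unitmxE unitfE ifT //; near: i.
exact: (cvgr_neq0 _ dA d0).
Unshelve. all: by end_near. Qed.

End MatrixCvg.

(** * Convergence in a vector bundle *)

Section Bundle.
Variables (R : realType) (X : topologicalType).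
Implicit Types E : vbundle R X.

(** Convergence, in the total space, of vectors lying in varying fibres.
    Testing continuity along all filters F turns the joint continuity of
    fibrewise maps into statements about such families, without any
    topology on fibre products. *)
Definition vcvg E (I : Type) (F : set_system I) (x : I -> X)
    (v : forall i, E (x i)) (x0 : X) (v0 : E x0) : Prop :=
  (vpt (v i) : vtot E) @[i --> F] --> (vpt v0 : vtot E).

(** A local trivialization seen from the fibres: coordinates, and their
    inverse which moves a fixed row vector through the nearby fibres. The
    last two fields say that convergence in the total space is convergence
    of base points and coordinates. *)
Record frame E := Frame {
  fr_dom : set X;
  fr_dim : nat;
  fr_coord : forall y, E y -> 'rV[R]_fr_dim;
  fr_vec : forall y, 'rV[R]_fr_dim -> E y;
  fr_open : open fr_dom;
  fr_linear : forall y, fr_dom y -> linear (@fr_coord y);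
  fr_coordK : forall y, fr_dom y -> cancel (@fr_coord y) (@fr_vec y);
  fr_vecK : forall y, fr_dom y -> cancel (@fr_vec y) (@fr_coord y);
  fr_coord_cvg : forall (I : Type) (F : set_system I) (FF : Filter F)
    (x : I -> X) (v : forall i, E (x i)) y (v0 : E y), fr_dom y ->
    vcvg F v v0 -> fr_coord (v i) @[i --> F] --> fr_coord v0;
  fr_cvg : forall (I : Type) (F : set_system I) (FF : Filter F)
    (x : I -> X) (v : forall i, E (x i)) y (v0 : E y), fr_dom y ->
    x @ F --> y -> fr_coord (v i) @[i --> F] --> fr_coord v0 -> vcvg F v v0 }.

Arguments fr_vec {E} f y r.
Arguments fr_coord {E} f {y} v.

Lemma frame_at E (x0 : X) : exists f : frame E, fr_dom f x0.
Proof.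
have [U [n [phi [psi [Ux0 [oU hphi hpsi lphi]]]]]] := @vbundle_locally_trivial _ _ E x0.
pose c y (v : E y) : 'rV[R]_n := phi (vpt v).
have vex y r : U y -> exists v : E y, vpt v = psi (y, r).
  move=> Uy; have [_ pr _] := hpsi y r Uy.
  by have := @vpt_surj _ _ E (psi (y, r)); rewrite pr.
pose fr y r : E y := xget 0 [set v : E y | vpt v = psi (y, r)].
have frE y r : U y -> vpt (fr y r) = psi (y, r).
  by move=> /(vex y r) h; rewrite /fr; exact: (xgetPex 0 h).
have psiE y (v : E y) : U y -> psi (y, phi (vpt v)) = vpt v.
  by move=> Uy; have := hphi (vpt v); rewrite vptK => /(_ Uy)[].
unshelve eexists; first apply: (@Frame E U n c fr oU).
- by move=> y Uy; exact: lphi.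
- by move=> y Uy v; apply: (@vpt_inj _ _ E); rewrite frE // psiE.
- by move=> y Uy r; rewrite /c frE //; case: (hpsi y r Uy).
- move=> I F FF x v y v0 Uy h.
  have Uv : U (vproj (vpt v0)) by rewrite vptK.
  have [cphi _] := hphi _ Uv.
  exact: (cvg_comp (fun i => vpt (v i)) phi h cphi).
- move=> I F FF x v y v0 Uy hx h.
  have [cpsi _ _] := hpsi y (c y v0) Uy.
  have : psi (x i, c _ (v i)) @[i --> F] --> vpt v0.
    rewrite -(psiE _ v0 Uy).
    exact: (cvg_comp (fun i => (x i, c _ (v i))) psi (cvg_pair hx h) cpsi).
  apply: cvg_trans; apply: near_eq_cvg; near=> i.
  rewrite psiE //; near: i; apply: hx.
  exact: open_nbhs_nbhs.
- exact: Ux0.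
Unshelve. all: by end_near. Qed.

Lemma vcvg_base E I (F : set_system I) (FF : Filter F) (x : I -> X)
    (v : forall i, E (x i)) x0 (v0 : E x0) :
  vcvg F v v0 -> x @ F --> x0.
Proof.
move=> h; have := cvg_comp _ (@vproj _ _ E) h (@vproj_continuous _ _ E (vpt v0)).
by rewrite vptK; apply: cvg_trans; apply: near_eq_cvg; near=> i; rewrite /= vptK.
Unshelve. all: by end_near. Qed.

Lemma frame_near E (f : frame E) I (F : set_system I) (x : I -> X) (x0 : X) :
  fr_dom f x0 -> x @ F --> x0 -> \forall i \near F, fr_dom f (x i).
Proof. by move=> fx0; apply; apply: open_nbhs_nbhs; split=> //; exact: fr_open. Qed.

Lemma fr_vec_cvg E (f : frame E) I (F : set_system I) (FF : Filter F) (x : I -> X) (x0 : X)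
    (r : I -> 'rV[R]_(fr_dim f)) (r0 : 'rV[R]_(fr_dim f)) :
  fr_dom f x0 -> x @ F --> x0 -> r @ F --> r0 ->
  vcvg F (fun i => fr_vec f (x i) (r i)) (fr_vec f x0 r0).
Proof.
move=> fx0 hx hr; apply: (fr_cvg FF fx0 hx); rewrite fr_vecK //.
apply: cvg_trans hr; apply: near_eq_cvg; near=> i.
rewrite fr_vecK //; near: i; exact: frame_near hx.
Unshelve. all: by end_near. Qed.

Lemma vcvg_near E I (F : set_system I) (FF : Filter F) (x : I -> X)
    (u v : forall i, E (x i)) x0 (u0 : E x0) :
  (\forall i \near F, u i = v i) -> vcvg F u u0 -> vcvg F v u0.
Proof.
move=> h; apply: cvg_trans; apply: near_eq_cvg.
by apply: filterS h => i ->.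
Qed.

Lemma vcvgDZ E I (F : set_system I) (FF : Filter F) (x : I -> X)
    (a : I -> R) (a0 : R) (u v : forall i, E (x i)) x0 (u0 v0 : E x0) :
  a @ F --> a0 -> vcvg F u u0 -> vcvg F v v0 ->
  vcvg F (fun i => a i *: u i + v i) (a0 *: u0 + v0).
Proof.
move=> ha hu hv; have hx := vcvg_base FF hu; have [f fx0] := frame_at E x0.
apply: (fr_cvg FF fx0 hx); rewrite fr_linear //.
have : a i *: fr_coord f (u i) + fr_coord f (v i) @[i --> F] -->
    a0 *: fr_coord f u0 + fr_coord f v0.
  apply/mx_cvgP => k l; rewrite !mxE; under eq_fun do rewrite !mxE.
  have /mx_cvgP/(_ k l) h1 := fr_coord_cvg FF fx0 hu.
  have /mx_cvgP/(_ k l) h2 := fr_coord_cvg FF fx0 hv.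
  by apply: cvgD => //; exact: cvgM.
apply: cvg_trans; apply: near_eq_cvg; near=> i.
rewrite fr_linear //; near: i; exact: frame_near hx.
Unshelve. all: by end_near. Qed.

Lemma vcvgD E I (F : set_system I) (FF : Filter F) (x : I -> X)
    (u v : forall i, E (x i)) x0 (u0 v0 : E x0) :
  vcvg F u u0 -> vcvg F v v0 -> vcvg F (fun i => u i + v i) (u0 + v0).
Proof.
move=> hu hv; have c1 : (fun=> 1 : R) @ F --> (1 : R) by exact: cvg_cst.
have := vcvgDZ FF c1 hu hv.
by rewrite scale1r; apply: vcvg_near => //; near=> i; rewrite scale1r.
Unshelve. all: by end_near.
Qed.

Lemma vcvg0 E I (F : set_system I) (FF : Filter F) (x : I -> X) (x0 : X) :
  x @ F --> x0 -> vcvg F (fun i => 0 : E (x i)) (0 : E x0).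
Proof.
move=> hx; have [f fx0] := frame_at E x0; apply: (fr_cvg FF fx0 hx).
have c0 y : fr_dom f y -> fr_coord f (0 : E y) = 0.
  by move=> fy; have := fr_linear fy (-1) 0 0; rewrite scaler0 addr0 scaleN1r addNr.
rewrite c0 //; apply: (@cvg_trans _ ((fun=> 0) @ F)); last exact: cvg_cst.
apply: near_eq_cvg; near=> i; rewrite c0 //; near: i; exact: frame_near hx.
Unshelve. all: by end_near. Qed.

(** Continuity of f on the product of T with the fibre product of E and E',
    tested along filters. *)
Definition fcont (T : topologicalType) (E E' : vbundle R X) (S : topologicalType)
    (f : T -> forall x, E x -> E' x -> S) : Prop :=
  forall (I : Type) (F : set_system I) (FF : Filter F) (t : I -> T) (t0 : T)
    (x : I -> X) x0 (u : forall i, E (x i)) (u0 : E x0)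
    (v : forall i, E' (x i)) (v0 : E' x0),
    t @ F --> t0 -> vcvg F u u0 -> vcvg F v v0 ->
    f (t i) (x i) (u i) (v i) @[i --> F] --> f t0 x0 u0 v0.

Definition mxform n (Q : 'M[R]_n) (u v : 'rV[R]_n) : R := (u *m Q *m v^T) 0 0.

Lemma mxformE n (Q : 'M[R]_n) u v :
  mxform Q u v = \sum_k \sum_l u 0 k * v 0 l * Q k l.
Proof.
rewrite /mxform mxE exchange_big; apply: eq_bigr => l _.
rewrite !mxE mulr_suml; apply: eq_bigr => k _; ring.
Qed.

Definition gram E (f : frame E) (h : forall y, E y -> E y -> R) y : 'M[R]_(fr_dim f) :=
  \matrix_(k, l) h y (fr_vec f y (delta_mx 0 k)) (fr_vec f y (delta_mx 0 l)).

Lemma fr_vec_linear E (f : frame E) y : fr_dom f y -> linear (fr_vec f y).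
Proof.
move=> fy a u v; rewrite -[RHS](fr_coordK fy); congr fr_vec.
by rewrite fr_linear // !fr_vecK.
Qed.

Lemma fr_vec_sum E (f : frame E) y (r : 'rV[R]_(fr_dim f)) : fr_dom f y ->
  fr_vec f y r = \sum_k r 0 k *: fr_vec f y (delta_mx 0 k).
Proof.
move=> fy; pose l := GRing.isLinear.Build _ _ _ _ _ (fr_vec_linear fy).
pose L : {linear 'rV[R]_(fr_dim f) -> E y} := HB.pack (fr_vec f y) l.
rewrite -[fr_vec f y]/(L : _ -> _) {1}(row_sum_delta r) linear_sum.
by apply: eq_bigr => k _; rewrite linearZ.
Qed.

Lemma gramE E (f : frame E) (h : forall y, E y -> E y -> R) y u v :
  is_ip (h y) -> fr_dom f y ->
  h y (fr_vec f y u) (fr_vec f y v) = mxform (gram f h y) u v.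
Proof.
move=> ih fy; rewrite mxformE (fr_vec_sum u fy) (ip_suml ih); apply: eq_bigr => k _.
rewrite (ip_Zl ih) (fr_vec_sum v fy) (ip_sgC ih) (ip_suml ih) mulr_sumr.
by apply: eq_bigr => l _; rewrite (ip_Zl ih) mxE (ip_sgC ih) mulrA.
Qed.

Lemma gram_cvg (T : topologicalType) E (f : frame E) (g : T -> forall y, E y -> E y -> R)
    I (F : set_system I) (FF : Filter F) (t : I -> T) (t0 : T) (x : I -> X) (x0 : X) :
  fcont g -> fr_dom f x0 -> t @ F --> t0 -> x @ F --> x0 ->
  gram f (g (t i)) (x i) @[i --> F] --> gram f (g t0) x0.
Proof.
move=> cg fx0 ht hx; apply/mx_cvgP => k l; rewrite mxE; under eq_fun do rewrite mxE.
by apply: cg => //; apply: fr_vec_cvg => //; exact: cvg_cst.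
Qed.

Lemma cvg_mxform n I (F : set_system I) (FF : Filter F) (Q : I -> 'M[R]_n)
    (Q0 : 'M[R]_n) (u : I -> 'rV[R]_n) (u0 : 'rV[R]_n) (v : I -> 'rV[R]_n) (v0 : 'rV[R]_n) :
  Q @ F --> Q0 -> u @ F --> u0 -> v @ F --> v0 ->
  mxform (Q i) (u i) (v i) @[i --> F] --> mxform Q0 u0 v0.
Proof.
move=> hQ hu hv; apply: (mx_cvgP _ _).1.
by apply: cvg_mulmx; [exact: cvg_mulmx | exact: cvg_trmx].
Qed.

Lemma mxform_is_ip E (f : frame E) (h : forall y, E y -> E y -> R) y :
  is_ip (h y) -> fr_dom f y -> is_ip (mxform (gram f h y)).
Proof.
move=> ih fy; split=> [v a u w|u v|u u0].
- by rewrite -!gramE // (fr_vec_linear fy) (ip_Dl ih) (ip_Zl ih).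
- by rewrite -!gramE // (ip_sgC ih).
- rewrite -gramE // (ip_gt0 ih) //; apply: contra_neq u0 => h0.
  have := fr_vec_linear fy (-1) 0 0; rewrite scaler0 addr0 scaleN1r addNr => e.
  by rewrite -(fr_vecK fy u) h0 -e fr_vecK.
Qed.

Lemma mxform_unit n (Q : 'M[R]_n) : is_ip (mxform Q) -> Q \in unitmx.
Proof.
move=> ih; rewrite -row_free_unit; apply/inj_row_free => u uQ.
by apply: (ip_eq0 ih); rewrite /mxform uQ mul0mx mxE.
Qed.

(** A vector is recovered from its inner products with the frame by the
    inverse of the Gram matrix, which is continuous. Hence a family
    defined by Riesz duality converges as soon as its inner products do. *)
Lemma vcvg_ip (T : topologicalType) E (g : T -> forall x, E x -> E x -> R) :
  (forall t x, is_ip (g t x)) -> fcont g ->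
  forall I (F : set_system I) (FF : Filter F) (t : I -> T) (t0 : T) (x : I -> X) (x0 : X)
    (h : forall i, E (x i)) (h0 : E x0), t @ F --> t0 -> x @ F --> x0 ->
  (forall (w : forall i, E (x i)) (w0 : E x0), vcvg F w w0 ->
     g (t i) (x i) (h i) (w i) @[i --> F] --> g t0 x0 h0 w0) -> vcvg F h h0.
Proof.
move=> ig cg I F FF t t0 x x0 h h0 ht hx hh.
have [f fx0] := frame_at E x0; apply: (fr_cvg FF fx0 hx).
pose r t y (v : E y) : 'rV[R]_(fr_dim f) := \row_l g t y v (fr_vec f y (delta_mx 0 l)).
have cr s y (v : E y) : fr_dom f y ->
    fr_coord f v = r s y v *m invmx (gram f (g s) y).
  move=> fy; have u := mxform_unit (mxform_is_ip (ig s y) fy).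
  apply: (canRL (mulmxK u)); apply/rowP => l; rewrite !mxE.
  rewrite -[in RHS](fr_coordK fy v) (fr_vec_sum _ fy) (ip_suml (ig _ _)).
  by apply: eq_bigr => k _; rewrite (ip_Zl (ig _ _)) mxE.
rewrite (cr t0) //.
apply: (@cvg_trans _ ((fun i => r (t i) (x i) (h i) *m invmx (gram f (g (t i)) (x i))) @ F)).
  apply: near_eq_cvg; near=> i; rewrite (cr (t i)) //; near: i; exact: frame_near hx.
apply: cvg_mulmx.
  apply/mx_cvgP => k l; rewrite mxE; under eq_fun do rewrite mxE.
  by apply: hh; apply: fr_vec_cvg => //; exact: cvg_cst.
apply: cvg_invmx; last exact: gram_cvg.
exact: mxform_unit (mxform_is_ip (ig _ _) fx0).
Unshelve. all: by end_near. Qed.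

(** * Continuity of the square root *)

Lemma mx_cvg_unique m n (I : Type) (F : set_system I) (FF : ProperFilter F)
    (A B : I -> 'M[R]_(m, n)) (A0 B0 : 'M[R]_(m, n)) :
  A @ F --> A0 -> B @ F --> B0 -> (\forall i \near F, A i = B i) -> A0 = B0.
Proof.
move=> /mx_cvgP hA /mx_cvgP hB AB; apply/matrixP => k l.
apply: (cvg_unique (@norm_hausdorff R R^o) (hA k l)).
apply: cvg_trans (hB k l); apply: near_eq_cvg.
by apply: filterS AB => i ->.
Qed.

Lemma mxform_inj n (A B : 'M[R]_n) : (forall u v, mxform A u v = mxform B u v) -> A = B.
Proof.
have e (Q : 'M[R]_n) k l : mxform Q (delta_mx 0 k) (delta_mx 0 l) = Q k l.
  by rewrite /mxform trmx_delta -rowE -colE !mxE.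
by move=> h; apply/matrixP => k l; rewrite -!e h.
Qed.

Lemma mxform_delta n (Q : 'M[R]_n) u k : mxform Q u (delta_mx 0 k) = (u *m Q) 0 k.
Proof. by rewrite /mxform trmx_delta -colE mxE. Qed.

Lemma mxform_mulmx n (M Q : 'M[R]_n) u v : mxform Q (u *m M) v = mxform (M *m Q) u v.
Proof. by rewrite /mxform !mulmxA. Qed.

(** With Q the matrix of the form g (P -) -, the operator P has matrix Q G^-1,
    and the equation for the square root becomes Q G^-1 Q = B. The unknown
    Q, unlike P, is a symmetric matrix in any frame. *)
Lemma sqrt_mx n (G B Q : 'M[R]_n) : is_ip (mxform G) -> Q^T = Q ->
  (forall u, 0 <= mxform Q u u) -> Q *m invmx G *m Q = B ->
  is_sqrt (mxform G) (mxform B) (fun u => u *m (Q *m invmx G)).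
Proof.
move=> iG QT Q0 QB; have uG := mxform_unit iG.
have GP u v : mxform G (u *m (Q *m invmx G)) v = mxform Q u v.
  by rewrite mxform_mulmx mulmxKV.
have Qsym u v : mxform Q u v = mxform Q v u.
  rewrite !mxformE exchange_big; apply: eq_bigr => l _; apply: eq_bigr => k _.
  by rewrite -[in LHS]QT mxE (mulrC (u 0 k)).
split=> [u v|u|u v]; first by rewrite GP (ip_sgC iG u) GP Qsym.
  by rewrite GP.
by rewrite (ip_sgC iG) GP Qsym mxform_mulmx QB.
Qed.

Lemma gram_sqrt E (f : frame E) (g b : forall y, E y -> E y -> R)
    (P : forall y, E y -> E y) y :
  is_ip (g y) -> is_ip (b y) -> is_sqrt (g y) (b y) (P y) -> fr_dom f y ->
  let Q := gram f (fun y u v => g y (P y u) v) y in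
  [/\ Q^T = Q, forall u, 0 <= mxform Q u u &
      Q *m invmx (gram f g y) *m Q = gram f b y].
Proof.
move=> ig ib sP fy Q; have iq := sqrt_ip ig ib sP.
have Qf u v : mxform Q u v = g y (P y (fr_vec f y u)) (fr_vec f y v).
  by rewrite -(@gramE _ f (fun y u v => g y (P y u) v)).
have uG := mxform_unit (mxform_is_ip ig fy).
have cP u : fr_coord f (P y (fr_vec f y u)) = u *m (Q *m invmx (gram f g y)).
  rewrite mulmxA; apply: (canRL (mulmxK uG)); apply/rowP => k.
  rewrite -!mxform_delta Qf -{2}[P y _](fr_coordK fy).
  by rewrite (gramE _ _ ig fy).
split.
- by apply/matrixP => k l; rewrite !mxE (ip_sgC iq).
- by move=> u; rewrite Qf (ip_ge0 iq).
- apply: mxform_inj => u v; rewrite -(gramE _ _ ib fy) -mxform_mulmx -cP Qf.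
  by rewrite fr_coordK //; case: sP => sa _ <-; rewrite sa.
Qed.

(** The a priori bound behind the compactness argument: g (P w - w) (P w - w)
    >= 0 gives 2 g (P w) w <= g w w + b w w, and off the diagonal one uses
    positivity at u + v and at u - v. *)
Lemma sqrt_bound (V : vectType R) (g b : V -> V -> R) P u v :
  is_ip g -> is_ip b -> is_sqrt g b P ->
  `|g (P u) v| <= g u u + b u u + (g v v + b v v).
Proof.
move=> ig ib sP; have iq := sqrt_ip ig ib sP.
have diag w : g (P w) w <= g w w + b w w.
  have := ip_ge0 ig (P w - w); case: sP => _ _ h.
  rewrite (ip_Bl ig) !(ip_Br ig) h (ip_sgC ig w (P w)).
  have := ip_ge0 iq w; lra.
have := ip_ge0 iq (u + v); have := ip_ge0 iq (u - v).
rewrite (ip_Bl iq) !(ip_Br iq) (ip_Dl iq) !(ip_Dr iq) (ip_sgC iq v u).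
have := diag u; have := diag v; have := ip_ge0 ig u; have := ip_ge0 ig v.
have := ip_ge0 ib u; have := ip_ge0 ib v => *.
rewrite ler_norml; apply/andP; split; lra.
Qed.

(** The matrix of g (P -) - stays bounded, so it has a limit along each
    ultrafilter. The limit solves the same equation and is still
    nonnegative, so by uniqueness it is the value at the limit point. *)
Lemma sqrt_fcont (T : topologicalType) E (g b : T -> forall x, E x -> E x -> R)
    (P : T -> forall x, E x -> E x) :
  (forall t x, is_ip (g t x)) -> (forall t x, is_ip (b t x)) ->
  fcont g -> fcont b -> (forall t x, is_sqrt (g t x) (b t x) (P t x)) ->
  fcont (fun t x u v => g t x (P t x u) v : R).
Proof.
move=> ig ib cg cb sP I F FF t t0 x x0 u u0 v v0 ht hu hv.
have hx := vcvg_base FF hu; have [f fx0] := frame_at E x0.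
have fx := frame_near fx0 hx.
pose q s y (u v : E y) := g s y (P s y u) v.
have iq s y : is_ip (q s y) by exact: sqrt_ip (sP s y).
pose Q i := gram f (q (t i)) (x i); pose Q0 := gram f (q t0) x0.
suff hQ : Q @ F --> Q0.
  have := cvg_mxform FF hQ (fr_coord_cvg FF fx0 hu) (fr_coord_cvg FF fx0 hv).
  rewrite -gramE ?fr_coordK //; apply: cvg_trans; apply: near_eq_cvg.
  by apply: filterS fx => i fi; rewrite /Q -gramE ?fr_coordK.
have hG := gram_cvg FF cg fx0 ht hx.
have hB := gram_cvg FF cb fx0 ht hx.
apply: cvg_ultra => U UU FU; have UP := @ultra_proper _ _ UU.
have toU (S : topologicalType) (h : I -> S) (l : S) : h @ F --> l -> h @ U --> l.
  by move=> hl A /hl; exact: FU.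
have lim k l : exists a : R, Q i k l @[i --> U] --> a.
  pose s (G B : 'M[R]_(fr_dim f)) := G k k + B k k + (G l l + B l l).
  have hs : s (gram f (g (t i)) (x i)) (gram f (b (t i)) (x i)) @[i --> F]
      --> s (gram f (g t0) x0) (gram f (b t0) x0).
    by move/mx_cvgP: hG => hG; move/mx_cvgP: hB => hB; do !apply: cvgD.
  set s0 := s _ _ in hs; have s1 : s0 < s0 + 1 by rewrite ltrDl.
  have near_s := FU _ (filterI fx (cvgr_le _ hs _ s1)).
  have {}near_s := near_s FF FF.
  have := @segment_compact R (- (s0 + 1)) (s0 + 1).
  rewrite compact_ultra => /(_ ((fun i => Q i k l) @ U)) [||a [_ ha]].
  - exact: ultra_map.
  - apply: (@filterS _ U _ _ _ _ near_s) => i [fi si] /=; rewrite in_itv /= -ler_norml.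
    apply: le_trans si; rewrite /s /Q !mxE.
    exact: (sqrt_bound _ _ (ig _ _) (ib _ _) (sP _ _)).
  - by exists a.
pose Q' := \matrix_(k, l) projT1 (cid (lim k l)).
have hQ' : Q @ U --> Q'.
  by apply/mx_cvgP => k l; rewrite mxE; case: (cid _).
suff <- : Q' = Q0 by [].
have G0i := mxform_is_ip (ig t0 x0) fx0.
have fU := FU _ fx.
have near_eq i : fr_dom f (x i) -> [/\ (Q i)^T = Q i, forall u, 0 <= mxform (Q i) u u &
    Q i *m invmx (gram f (g (t i)) (x i)) *m Q i = gram f (b (t i)) (x i)].
  by move=> fi; exact: gram_sqrt.
have s' : is_sqrt (mxform (gram f (g t0) x0)) (mxform (gram f (b t0) x0))
    (fun u => u *m (Q' *m invmx (gram f (g t0) x0))).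
  apply: sqrt_mx => //.
  - apply: (mx_cvg_unique UP (cvg_trmx hQ') hQ').
    by apply: filterS fU => i /near_eq[].
  - move=> r; have h := cvg_mxform _ hQ' (cvg_cst r) (cvg_cst r).
    apply: (cvgr_to_ge (h _ _ _)); apply: filterS fU => i /near_eq[_ + _]; exact.
  - have hi : invmx (gram f (g (t i)) (x i)) @[i --> U] --> invmx (gram f (g t0) x0).
      apply: cvg_invmx; first exact: mxform_unit G0i.
      exact: toU hG.
    apply: (mx_cvg_unique UP (cvg_mulmx (cvg_mulmx hQ' hi) hQ') (toU _ _ _ hB)).
    by apply: filterS fU => i /near_eq[].
have s0 : is_sqrt (mxform (gram f (g t0) x0)) (mxform (gram f (b t0) x0))
    (fun u => u *m (Q0 *m invmx (gram f (g t0) x0))).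
  have [? ? ?] := @gram_sqrt _ f (g t0) (b t0) (P t0) x0 (ig _ _) (ib _ _) (sP _ _) fx0.
  exact: sqrt_mx.
have := sqrt_unique G0i (mxform_is_ip (ib t0 x0) fx0) s' s0.
move=> e; apply: (can_inj (mulmxKV (mxform_unit G0i))).
apply/row_matrixP => i.
by have := congr1 (fun h => h (delta_mx 0 i)) e; rewrite -!rowE.
Qed.

End Bundle.

Arguments fr_vec {R X E} f y r.
Arguments fr_coord {R X E} f {y} v.

(** * Existence of metrics *)

Section Metric.
Variables (R : realType) (X : topologicalType).
Implicit Types E : vbundle R X.

Definition is_psd E (k : forall x, E x -> E x -> R) : Prop :=
  [/\ forall x v, linear (k x ^~ v : E x -> R^o), forall x u v, k x u v = k x v u,
      forall x u, 0 <= k x u u & forall T : topologicalType, fcont (fun _ : T => k)].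

(** A trivialization provides a metric near x0, which is cut off by a function
    vanishing near the complement of the chart. *)
Lemma local_psd E x0 : compact [set: X] -> hausdorff_space X ->
  exists (k : forall x, E x -> E x -> R) (W : set X),
    [/\ open W, W x0, is_psd k & forall y (u : E y), W y -> u != 0 -> 0 < k y u u].
Proof.
move=> cX hX; have [f fx0] := frame_at E x0.
have cf : closed (~` fr_dom f) by apply: open_closedC; exact: fr_open.
have c0 : closed [set x0] by apply: accessible_closed_set1; exact: hausdorff_accessible.
have dis : ~` fr_dom f `&` [set x0] = set0.
  by apply/seteqP; split=> // y [+ yx]; rewrite yx.
have usep : uniform_separator (~` fr_dom f) [set x0].
  exact: ((@normal_separatorP R X).1 (compact_normal hX cX)).
pose rho : X -> R := Urysohn (~` fr_dom f) [set x0].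
have crho : continuous rho by exact: Urysohn_continuous.
have rho0 y : ~ fr_dom f y -> rho y = 0.
  by move=> fy; have := Urysohn_sub0 (R := R) usep; apply; exists y.
have rho1 : rho x0 = 1.
  by have := Urysohn_sub1 (R := R) usep; apply; exists x0.
(* The function eta vanishes where rho <= 1/2, an open condition around each
   point outside of the chart; rho itself would only vanish at such
   points. *)
pose eta y := `|rho y - 2^-1| + (rho y - 2^-1).
have eta0 y : 0 <= eta y.
  by rewrite /eta; have := lerNnormlW (lexx `|rho y - 2^-1|); lra.
have etaz y : rho y <= 2^-1 -> eta y = 0.
  by move=> h; rewrite /eta ler0_norm ?subr_le0 // addNr.
have etap y : 2^-1 < rho y -> 0 < eta y.
  by move=> h; rewrite ltr_wpDl ?subr_gt0.
pose k y (u v : E y) := eta y * \sum_j fr_coord f u 0 j * fr_coord f v 0 j.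
exists k, (fr_dom f `&` [set y | 2^-1 < rho y]); split.
- apply: openI; first exact: fr_open.
  have /continuousP/(_ [set r : R | 2^-1 < r]) := crho.
  by apply; exact: open_gt.
- by split=> //=; rewrite rho1; lra.
- split=> [y v a u w|y u v|y u|T I F FF t t0 x y0 u u0 v v0 _ hu hv].
  + rewrite /k; have [fy|/rho0 fy] := pselect (fr_dom f y); last first.
      by rewrite etaz ?fy ?invr_ge0 // !mul0r scaler0 addr0.
    rewrite /GRing.scale /= mulrCA -mulrDr; congr (_ * _).
    rewrite mulr_sumr -big_split; apply: eq_bigr => j _.
    by rewrite fr_linear // !mxE mulrDl mulrA.
  + by rewrite /k; congr (_ * _); apply: eq_bigr => j _; rewrite mulrC.
  + by rewrite /k mulr_ge0 // sumr_ge0 // => j _; rewrite -expr2 sqr_ge0.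
  + have hx := vcvg_base FF hu; have hr := cvg_comp x rho hx (crho y0).
    have [fy|fy] := pselect (fr_dom f y0).
      apply: cvgM.
        have hd : rho (x i) - 2^-1 @[i --> F] --> rho y0 - 2^-1.
          by apply: cvgB => //; exact: cvg_cst.
        by apply: cvgD => //; exact: (@cvg_norm _ R^o).
      apply: cvg_sumr => j _; apply: cvgM.
        by have /mx_cvgP := fr_coord_cvg FF fy hu; apply.
      by have /mx_cvgP := fr_coord_cvg FF fy hv; apply.
    rewrite /k etaz ?rho0 ?invr_ge0 // mul0r.
    apply: (@cvg_trans _ ((fun=> 0) @ F)); last exact: cvg_cst.
    have half : rho y0 < 2^-1 by rewrite rho0 // invr_gt0.
    apply: near_eq_cvg; apply: filterS (cvgr_lt _ hr _ half) => i /ltW hi.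
    by rewrite etaz // mul0r.
- move=> y u [fy /= ry] u0; rewrite /k mulr_gt0 ?etap //.
  rewrite lt_neqAle sumr_ge0 ?andbT; last by move=> j _; rewrite -expr2 sqr_ge0.
  apply: contra_neqN u0 => /eqP/esym s0.
  rewrite -(fr_coordK fy u) -(fr_coordK fy 0); congr fr_vec.
  have := fr_linear fy (-1) 0 0; rewrite scaler0 addr0 scaleN1r addNr => ->.
  apply/rowP => j; rewrite mxE; apply/eqP; rewrite -(sqrf_eq0 (fr_coord f u 0 j)).
  have /allP h : all (fun j => (true ==> (fr_coord f u 0 j ^+ 2 == 0))) (index_enum _).
    rewrite -psumr_eq0 => [|i _]; last exact: sqr_ge0.
    by under eq_bigr do rewrite expr2; apply/eqP.
  by have := h j (mem_index_enum _).
Qed.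

(** The sets outside of which some continuous nonnegative form is definite
    make a filter, sums of forms giving intersections. By local_psd this
    filter has no cluster point, so by compactness it contains the empty
    set: some form is definite everywhere. This replaces a partition of
    unity. *)
Lemma metric_exists E : compact [set: X] -> hausdorff_space X ->
  exists g : forall x, E x -> E x -> R, (forall x, is_ip (g x)) /\
    forall T : topologicalType, fcont (fun _ : T => g).
Proof.
move=> cX hX.
pose F := [set A : set X | exists2 k : forall x, E x -> E x -> R, is_psd k &
  forall y (u : E y), ~ A y -> u != 0 -> 0 < k y u u].
have FF : Filter F.
  split.
  - exists (fun _ _ _ => 0); last by move=> y u /(_ I).
    split=> // [x v a u w|T I Fi FFi *]; last exact: cvg_cst.
    by rewrite scaler0 addr0.
  - move=> A B [k [lk sk pk ck] kA] [h [lh sh ph ch] hB].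
    exists (fun x u v => k x u v + h x u v).
      split=> [x v a u w|x u v|x u|T I Fi FFi t t0 x x0 u u0 v v0 ht hu hv].
      + by rewrite lk lh scalerDr addrACA.
      + by rewrite sk sh.
      + by rewrite addr_ge0.
      + by apply: cvgD; [exact: (ck T _ _ _ t t0) | exact: (ch T _ _ _ t t0)].
    move=> y u nAB u0; have [Ay|nA] := pselect (A y).
      by apply: ltr_wpDl => //; apply: hB => // By; exact: nAB.
    by apply: ltr_pwDl => //; exact: kA.
  - move=> A B AB [k pk kA]; exists k => // y u nB; apply: kA => Ay.
    exact/nB/AB.
suff [k [lk sk pk ck] kp] : F set0.
  exists k; split=> // x; split=> [v|u v|u u0]; [exact: lk|exact: sk|].
  exact: (kp x u (fun h => h) u0).
apply: contrapT => nF; have PF : ProperFilter F by exact: Build_ProperFilter.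
have [x0 [_ cl]] := cX F PF filterT.
have [k [W [oW Wx0 pk kW]]] := local_psd E x0 cX hX.
have FW : F (~` W) by exists k => // y u /contrapT; exact: kW.
by have [y []] := cl _ _ FW (open_nbhs_nbhs (conj oW Wx0)).
Qed.

End Metric.

(** * Quaternionic structures and forms on a fibre *)

(** An orthogonal pair of non-zero vectors spans a plane. *)
Lemma plane_eq0 (R : realType) (V : vectType R) (g : V -> V -> R) (a b w : V) :
  is_ip g -> \dim {:V} = 2%N -> a != 0 -> b != 0 -> g a b = 0 ->
  g w a = 0 -> g w b = 0 -> w = 0.
Proof.
move=> ig d2 a0 b0 ab wa wb.
have fr : free [:: a; b].
  rewrite free_cons span_seq1 seq1_free b0 andbT.
  apply/negP => /vlineP[k e]; move: ab; rewrite e (ip_Zl ig) => /eqP.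
  rewrite mulf_eq0 (gt_eqF (ip_gt0 ig b0)) orbF => /eqP k0.
  by move: a0; rewrite e k0 scale0r eqxx.
have full : (<<[:: a; b]>> = fullv)%VS.
  by apply/eqP; rewrite eqEdim subvf d2 (eqP fr).
have : w \in (<<[:: a; b]>>)%VS by rewrite full memvf.
rewrite span_cons span_seq1 => /memv_addP[_ /vlineP[s ->] [_ /vlineP[t ->] e]].
by apply: (ip_eq0 ig); rewrite {2}e (ip_Dr ig) !(ip_Zr ig) wa wb !mulr0 addr0.
Qed.

Lemma linearDP (R : realType) (U V : lmodType R) (f : U -> V) :
  linear f -> {morph f : u v / u + v}.
Proof. by move=> l u v; have := l 1 u v; rewrite !scale1r. Qed.

Lemma linear0P (R : realType) (U V : lmodType R) (f : U -> V) : linear f -> f 0 = 0.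
Proof. by move=> l; apply: (@addrI _ (f 0)); rewrite -linearDP // !addr0. Qed.

Lemma linearZP (R : realType) (U V : lmodType R) (f : U -> V) a u :
  linear f -> f (a *: u) = a *: f u.
Proof.
by move=> l; have := l a u 0; rewrite !addr0 (linear0P l) addr0.
Qed.

Lemma linearNP (R : realType) (U V : lmodType R) (f : U -> V) :
  linear f -> {morph f : u / - u}.
Proof. by move=> l u; rewrite -scaleN1r linearZP // scaleN1r. Qed.

Section Fibre.
Variables (R : realType) (X : topologicalType) (delta : rline R X).

Lemma inner_product_ip (E : vbundle R X) (g : inner_product E) x : is_ip (ip g (x := x)).
Proof.
split; [|exact: ip_sym | exact: ip_posdef].
by move=> v a u w; have [_ h] := ip_bilinear g x; exact: h.
Qed.

Local Notation "<| d , e |>" := (ip (rl_ip delta) d e).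

Lemma rl_span x (e d : delta x) : e != 0 -> exists a, d = a *: e.
Proof.
move=> e0; apply/vlineP; suff -> : (<[e]>)%VS = fullv by rewrite memvf.
by apply/eqP; rewrite eqEdim subvf dim_vline e0 rl_dim.
Qed.

Lemma rl_unit x : exists e : delta x, <|e, e|> = 1.
Proof.
have id_ := inner_product_ip (rl_ip delta) x.
pose f : delta x := vpick fullv.
have f0 : f != 0 by rewrite vpick0 -dimv_eq0 rl_dim.
have fp := ip_gt0 id_ f0; exists ((Num.sqrt <|f, f|>)^-1 *: f).
rewrite (ip_Zl id_) (ip_Zr id_) mulrA -invfM -expr2 sqr_sqrtr ?ltW //.
by rewrite mulVf // gt_eqF.
Qed.

Section Cmodule.
Variables (E : Cbundle delta) (x : X).
Implicit Types (d e : delta x) (v w : E x).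

Lemma cact_linearl v : linear (fun z : Calg delta x => cact z v).
Proof. by have [[_ h] _ _] := cact_module E x; exact: h. Qed.

Lemma cact_linearr (z : Calg delta x) : linear (cact z : E x -> E x).
Proof. by have [[h _] _ _] := cact_module E x; exact: h. Qed.

Lemma dact_linearr d : linear (dact d : E x -> E x).
Proof. exact: cact_linearr. Qed.

Lemma dact_linearl v : linear (fun d : delta x => dact d v).
Proof.
move=> a d e; rewrite /dact -cact_linearl; congr cact; congr pair.
by rewrite /= scaler0 addr0.
Qed.

Lemma cactE (z : Calg delta x) v : cact z v = z.1 *: v + dact z.2 v.
Proof.
have [_ one _] := cact_module E x; case: z => s d.
rewrite -{2}(one v) /dact -cact_linearl; congr cact; congr pair => /=.
  by rewrite /GRing.scale /= mulr1 addr0.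
by rewrite scaler0 add0r.
Qed.

Lemma dactDr d v w : dact d (v + w) = dact d v + dact d w.
Proof. by rewrite (linearDP (dact_linearr d)). Qed.
Lemma dactZr d a v : dact d (a *: v) = a *: dact d v.
Proof. by rewrite (linearZP _ _ (dact_linearr d)). Qed.
Lemma dactNr d v : dact d (- v) = - dact d v.
Proof. by rewrite -scaleN1r dactZr scaleN1r. Qed.
Lemma dactDl d e v : dact (d + e) v = dact d v + dact e v.
Proof. by rewrite (linearDP (dact_linearl v)). Qed.
Lemma dactZl a d v : dact (a *: d) v = a *: dact d v.
Proof. by rewrite (linearZP _ _ (dact_linearl v)). Qed.
Lemma dact0l v : dact (0 : delta x) v = 0.
Proof. exact: linear0P (dact_linearl v). Qed.
Lemma dact0r d : dact d (0 : E x) = 0.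
Proof. exact: linear0P (dact_linearr d). Qed.

Lemma dactK d e v : dact d (dact e v) = - <|d, e|> *: v.
Proof.
have [_ one mul] := cact_module E x; rewrite /dact -mul cactE /=.
rewrite /Cmul /qmul /= mulr0 sub0r !scale0r !addr0.
by rewrite dact0l addr0.
Qed.

(** The metrics for which delta acts by skew operators, that is, the real
    parts of hermitian metrics. *)
Definition hermitian_ip (g : E x -> E x -> R) : Prop :=
  is_ip g /\ forall d v w, g (dact d v) w = - g v (dact d w).

(** Multiplication by the complex number a - d multiplies a hermitian metric
    by |a - d|^2. *)
Lemma herm_cmul g a d v w : hermitian_ip g ->
  g (a *: v - dact d v) (a *: w - dact d w) = (a ^+ 2 + <|d, d|>) * g v w.
Proof.
move=> [ig hg]; rewrite (ip_Bl ig) !(ip_Br ig) !(ip_Zl ig) !(ip_Zr ig) !hg.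
rewrite dactK (ip_Zr ig); ring.
Qed.

End Cmodule.

Section Line.
Variables (lambda : Cline delta) (x : X).
Local Notation "<[ u , v ]>" := (ip (cl_ip lambda) u v).
Implicit Types (d e : delta x) (u v : lambda x).

Lemma cl_ipP : is_ip (ip (cl_ip lambda) (x := x)).
Proof. exact: inner_product_ip. Qed.

Lemma cl_herm : hermitian_ip (ip (cl_ip lambda) (x := x)).
Proof.
split=> [|d u v]; first exact: cl_ipP.
have [e e1] := rl_unit x.
have e0 : e != 0.
  apply: contra_eq_neq e1 => ->.
  by rewrite (ip_0l (inner_product_ip (rl_ip delta) x)) eq_sym oner_eq0.
have [a ->] := rl_span d e0.
rewrite !dactZl (ip_Zl cl_ipP) (ip_Zr cl_ipP) -mulrN; congr (_ * _).
have := @cl_compat _ _ _ lambda x e u (dact e v) e1.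
by rewrite dactK e1 (ip_Zr cl_ipP) mulN1r => <-; rewrite opprK.
Qed.

Lemma cl_nonzero : exists u : lambda x, u != 0.
Proof. by exists (vpick fullv); rewrite vpick0 -dimv_eq0 cl_dim. Qed.

(** If u <> 0 and e is a unit vector of delta, then u and e u span the fibre
    of lambda. *)
Lemma cl_eq0 u w : u != 0 -> (forall d, <[w, dact d u]> = 0) -> <[w, u]> = 0 -> w = 0.
Proof.
move=> u0 wd wu; have [e e1] := rl_unit x.
apply: (@plane_eq0 _ _ _ u (dact e u) w cl_ipP (cl_dim _ _) u0) => //.
- apply/eqP => eu; have := dactK e e u; rewrite eu dact0r e1 scaleN1r => /esym/eqP.
  by rewrite oppr_eq0 (negPf u0).
- have [_ h] := cl_herm; have := h e u u; rewrite (ip_sgC cl_ipP (dact e u)); lra.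
Qed.

(** In the quaternions, with u v = - <u, v> + u /\ v, this is the identity
    |v|^2 u = - (u v) v. It writes any u as a complex multiple of any v <>
    0. *)
Lemma wedge_span u v : <[v, v]> *: u = <[u, v]> *: v - dact (wedge u v) v.
Proof.
have [_ h] := cl_herm.
have [->|v0] := eqVneq v 0.
  by rewrite (ip_0l cl_ipP) scale0r scaler0 dact0r subrr.
have [e e1] := rl_unit x.
have wv : <[dact (wedge u v) v, v]> = 0.
  by have := h (wedge u v) v v; rewrite (ip_sgC cl_ipP v); lra.
apply/eqP; rewrite -subr_eq0; apply/eqP; apply: (cl_eq0 v0) => [d|].
  rewrite !(ip_Bl cl_ipP) !(ip_Zl cl_ipP) (h (wedge u v)) opprK dactK (ip_Zr cl_ipP).
  rewrite -[<[u, dact d v]>]opprK -h -(wedgeP u v d).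
  have -> : <[v, dact d v]> = 0.
    by have := h d v v; rewrite (ip_sgC cl_ipP v); lra.
  ring.
by rewrite !(ip_Bl cl_ipP) !(ip_Zl cl_ipP) wv subr0 mulrC subrr.
Qed.

Lemma wedge_norm u v : v != 0 ->
  <[u, v]> ^+ 2 + <|wedge u v, wedge u v|> = <[v, v]> * <[u, u]>.
Proof.
move=> v0; have vv := ip_gt0 cl_ipP v0.
have := herm_cmul <[u, v]> (wedge u v) v v cl_herm.
rewrite -wedge_span (ip_Zl cl_ipP) (ip_Zr cl_ipP) => e.
by apply: (mulIf (lt0r_neq0 vv)); rewrite -e; ring.
Qed.

Lemma wedge0 u : wedge u (0 : lambda x) = 0.
Proof.
apply: (ip_inj (inner_product_ip (rl_ip delta) x)) => e.
by rewrite wedgeP (ip_0r cl_ipP) (ip_0l (inner_product_ip _ _)).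
Qed.

End Line.

Section Quaternionic.
Variables (lambda : Cline delta) (xi : Cbundle delta) (x : X).
Local Notation "<[ u , v ]>" := (ip (cl_ip lambda) u v).
Implicit Types (d e : delta x) (u : lambda x) (v w : xi x).

(** Real bilinear maps that are C_delta-linear in lambda and C_delta-
    antilinear in xi. This is what the action of lambda in an H_lambda-
    structure satisfies, and also what Riesz duality makes out of a form. *)
Definition is_sesqui (A : lambda x -> xi x -> xi x) : Prop :=
  [/\ Defs.bilinear A, forall d u v, A (dact d u) v = dact d (A u v)
    & forall d u v, A u (dact d v) = - dact d (A u v)].

(** Only the squares are prescribed: by wedge_span they determine the products
    J u (J u' v), see quat_mul. *)
Definition is_quaternionic (J : lambda x -> xi x -> xi x) : Prop :=
  is_sesqui J /\ forall u v, J u (J u v) = - <[u, u]> *: v.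

Definition acts_skew (g : xi x -> xi x -> R) (A : lambda x -> xi x -> xi x) : Prop :=
  forall u v w, g (A u v) w = - g v (A u w).

(** By wedge_span, A u is a complex multiple of A u', up to the positive
    factor |u'|^2. *)
Lemma sesqui_wedge A u u' v : is_sesqui A ->
  <[u', u']> *: A u v = <[u, u']> *: A u' v - dact (wedge u u') (A u' v).
Proof.
case=> -[_ lA] Ad _; rewrite -!(linearZP _ _ (lA v)) wedge_span.
by rewrite (linearDP (lA v)) -scaleN1r (linearZP (-1) _ (lA v)) scaleN1r Ad.
Qed.

Lemma quat_mul J u u' v : is_quaternionic J ->
  J u (J u' v) = - <[u, u']> *: v + dact (wedge u u') v.
Proof.
case=> cJ JJ; have [->|u0] := eqVneq u' 0.
  rewrite wedge0 (ip_0r (cl_ipP lambda x)) oppr0 scale0r dact0l addr0.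
  case: cJ => -[lr ll] _ _.
  by rewrite (linear0P (ll v)) (linear0P (lr u)).
have uu := lt0r_neq0 (ip_gt0 (cl_ipP lambda x) u0).
apply: (scalerI uu); rewrite sesqui_wedge // JJ dactZr !scalerA scalerDr !scalerA.
rewrite !mulrN !scaleNr opprK; congr (- (_ *: _) + _); exact: mulrC.
Qed.

(** The complex multiple relating A u to A u' has squared norm |u|^2 / |u'|^2,
    and hermitian metrics scale by it. So the form g (A u -) (A u -) /
    |u|^2 does not depend on u <> 0. *)
Lemma conformal g A u u' v w : hermitian_ip g -> is_sesqui A ->
  <[u', u']> * g (A u v) (A u w) = <[u, u]> * g (A u' v) (A u' w).
Proof.
move=> hg cA; have [ig _] := hg; have il := cl_ipP lambda x.
have A0 z : A 0 z = 0.
  by case: cA => -[_ ll] _ _; exact: linear0P (ll z).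
have [->|u0] := eqVneq u' 0; first by rewrite (ip_0l il) A0 (ip_0l ig) mulr0 mul0r.
have uu := lt0r_neq0 (ip_gt0 il u0).
apply: (mulfI uu); rewrite mulrA -[_ * _ * g _ _]mulrA.
rewrite -(ip_Zr ig) -(ip_Zl ig) !sesqui_wedge // (herm_cmul _ _ _ _ hg) wedge_norm //.
by rewrite mulrA.
Qed.

(** The average of g over the group generated by a unit vector of delta, up to
    a factor. Writing it in terms of an arbitrary d, not normalized, is
    what makes its continuity visible in fcont_quot. *)
Lemma herm_avg (g : xi x -> xi x -> R) : is_ip g ->
  exists h : xi x -> xi x -> R, hermitian_ip h /\
    forall d v w, ip (rl_ip delta) d d * h v w
      = ip (rl_ip delta) d d * g v w + g (dact d v) (dact d w).
Proof.
move=> ig; have [e e1] := rl_unit x.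
have id_ := inner_product_ip (rl_ip delta) x.
have e0 : e != 0.
  by apply: contra_eq_neq e1 => ->; rewrite (ip_0l id_) eq_sym oner_eq0.
pose h v w := g v w + g (dact e v) (dact e w); exists h.
have hE d v w : ip (rl_ip delta) d d * h v w
      = ip (rl_ip delta) d d * g v w + g (dact d v) (dact d w).
  have [a ->] := rl_span d e0.
  by rewrite !dactZl (ip_Zl id_) !(ip_Zr id_) (ip_Zl ig) (ip_Zr ig) e1 /h; ring.
split=> //; split.
  split=> [w a u v|u v|u u0]; rewrite /h.
  - by rewrite dactDr dactZr !(ip_Dl ig) !(ip_Zl ig) scalerDr addrACA.
  - by rewrite (ip_sgC ig) (ip_sgC ig (dact e u)).
  - by rewrite ltr_pwDl ?(ip_gt0 ig) ?(ip_ge0 ig).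
move=> d v w; have [a ->] := rl_span d e0; rewrite !dactZl /h.
rewrite !dactZr !dactK e1 !scaleN1r !(ip_Zl ig) !(ip_Zr ig) (ip_Nl ig) (ip_Nr ig); ring.
Qed.

(** The average of g over a unit vector u of lambda; by conformal it does not
    depend on u. The factor 1/2 makes it equal to g when g is already
    invariant. *)
Lemma quat_avg (g : xi x -> xi x -> R) J : hermitian_ip g -> is_quaternionic J ->
  exists q : xi x -> xi x -> R, [/\ hermitian_ip q, acts_skew q J &
    forall u v w, <[u, u]> * q v w
      = 2^-1 * (<[u, u]> * g v w + g (J u v) (J u w))].
Proof.
move=> hg [cJ JJ]; have [ig gd] := hg; have [u0 u0n] := cl_nonzero lambda x.
have il := cl_ipP lambda x; have uu := ip_gt0 il u0n.
have uun := lt0r_neq0 uu.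
pose q v w := 2^-1 * (g v w + g (J u0 v) (J u0 w) / <[u0, u0]>); exists q.
have qE u v w : <[u, u]> * q v w = 2^-1 * (<[u, u]> * g v w + g (J u v) (J u w)).
  have := conformal u u0 v w hg cJ; rewrite /q => e.
  apply: (mulfI uun); rewrite mulrDr mulrA.
  have -> : <[u0, u0]> * (2^-1 * (<[u, u]> * g v w + g (J u v) (J u w)))
    = 2^-1 * (<[u0, u0]> * <[u, u]> * g v w + <[u0, u0]> * g (J u v) (J u w)) by ring.
  by rewrite e; field.
have [[lr ll] Jd Jd'] := cJ.
split=> //.
  split.
    split=> [w a u v|u v|u un]; rewrite /q.
    - rewrite (linearDP (lr _)) (linearZP _ _ (lr _)) !(ip_Dl ig) !(ip_Zl ig).
      by rewrite /GRing.scale /=; ring.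
    - by rewrite (ip_sgC ig) (ip_sgC ig (J u0 u)).
    - rewrite mulr_gt0 ?invr_gt0 // ltr_pwDl ?(ip_gt0 ig) //.
      by rewrite mulr_ge0 ?(ip_ge0 ig) // invr_ge0 ltW.
  by move=> d v w; rewrite /q !Jd' (ip_Nl ig) (ip_Nr ig) !gd; ring.
move=> u v w; have [->|un] := eqVneq u 0.
  rewrite !(linear0P (ll _)) /q !(linear0P (lr _)) !(ip_0l ig) !(ip_0r ig).
  by rewrite !mul0r addr0 mulr0 oppr0.
have un0 := lt0r_neq0 (ip_gt0 il un).
apply: (mulfI un0); rewrite mulrN !qE !JJ (ip_Zl ig) (ip_Zr ig); ring.
Qed.

Definition is_form_of (w : xi x -> xi x -> lambda x) (q : xi x -> xi x -> R)
    (J : lambda x -> xi x -> xi x) : Prop :=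
  forall v v' u, <[w v v', u]> = q v (J u v').

Lemma form_of_exists (q : xi x -> xi x -> R) J : is_ip q -> is_sesqui J ->
  exists w : xi x -> xi x -> lambda x, is_form_of w q J.
Proof.
move=> iq [[_ ll] _ _].
have h v v' : exists a : lambda x, forall u, <[a, u]> = q v (J u v').
  have [|a ha] := riesz (cl_ipP lambda x) (f := fun u => q v (J u v')).
    by move=> c u u'; rewrite ll (ip_Dr iq) (ip_Zr iq).
  by exists a.
exists (fun v v' => projT1 (cid (h v v'))) => v v' u.
by case: (cid _).
Qed.

Section FormOf.
Variables (w : xi x -> xi x -> lambda x) (q : xi x -> xi x -> R)
  (J : lambda x -> xi x -> xi x).
Hypotheses (hq : hermitian_ip q) (qJ : is_quaternionic J) (sk : acts_skew q J)
  (wE : is_form_of w q J).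

Let iq := hq.1.
Let il := cl_ipP lambda x.
Lemma form_of_skew v v' : w v v' = - w v' v.
Proof.
apply: (ip_inj il) => u; rewrite (ip_Nl il) !wE.
by rewrite (ip_sgC iq v) sk (ip_sgC iq).
Qed.

Lemma form_of_Dl v v1 v' : w (v + v1) v' = w v v' + w v1 v'.
Proof. by apply: (ip_inj il) => u; rewrite (ip_Dl il) !wE (ip_Dl iq). Qed.

Lemma form_of_Zl a v v' : w (a *: v) v' = a *: w v v'.
Proof. by apply: (ip_inj il) => u; rewrite (ip_Zl il) !wE (ip_Zl iq). Qed.

Lemma form_of_dact d v v' : w (dact d v) v' = dact d (w v v').
Proof.
apply: (ip_inj il) => u; rewrite (cl_herm lambda x).2 !wE hq.2.
by have [[_ h _] _] := qJ; rewrite h.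
Qed.

Lemma form_of_Clinearl v' : Clinear (fun v => w v v').
Proof.
split=> [u v|z v]; first exact: form_of_Dl.
by rewrite !cactE form_of_Dl form_of_Zl form_of_dact.
Qed.

Lemma form_of_Clinearr v : Clinear (w v).
Proof.
have [hD hC] := form_of_Clinearl v; split=> [u v'|z v'].
  by rewrite form_of_skew hD opprD -!form_of_skew.
rewrite form_of_skew hC (form_of_skew v v').
by rewrite !cactE dactNr scalerN opprD.
Qed.

(** Given f and u <> 0, represent v |-> <f v, u> as q a -. Since J u is skew
    with square - |u|^2, the vector |u|^-2 J u a represents it through w,
    and C_delta-linearity carries the equality from the component along u
    to all of lambda. *)
Lemma form_of_nonsingular (f : xi x -> lambda x) : Clinear f -> exists! v, w v = f.
Proof.
move=> [fD fC]; have [u u0] := cl_nonzero lambda x.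
have fZ a v : f (a *: v) = a *: f v.
  have := fC (a, 0) v; rewrite !cactE /= !dact0l !addr0; exact.
have fd d v : f (dact d v) = dact d (f v).
  have := fC (0, d) v; rewrite !cactE /= !scale0r !add0r; exact.
have [|a ha] := riesz iq (f := fun v => <[f v, u]>).
  by move=> c v v'; rewrite fD fZ (ip_Dl il) (ip_Zl il).
have [[[lr ll] Jd Jd'] JJ] := qJ.
have uu := lt0r_neq0 (ip_gt0 il u0).
(* The solution of - J u b = a. *)
pose b := <[u, u]>^-1 *: J u a.
have bE v : <[w b v, u]> = <[f v, u]>.
  by rewrite wE ha /b (ip_Zl iq) sk JJ (ip_Zr iq); field.
exists b; split=> [|b' hb'].
  apply/funext => v; apply/eqP; rewrite -subr_eq0; apply/eqP.
  apply: (cl_eq0 u0) => [d|]; last by rewrite (ip_Bl il) bE subrr.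
  rewrite (ip_sgC il) (cl_herm lambda x).2 (ip_sgC il).
  have [wD wC] := form_of_Clinearr b.
  have wd : w b (dact d v) = dact d (w b v).
    by have := wC (0, d) v; rewrite !cactE /= !scale0r !add0r.
  by rewrite dactDr dactNr -wd -fd (ip_Bl il) bE subrr oppr0.
have e v : <[w b v, u]> = <[w b' v, u]> by rewrite bE hb'.
apply: (ip_inj iq) => v.
have vE : v = J u (- <[u, u]>^-1 *: J u v).
  rewrite (linearZP _ _ (lr _)) JJ scalerA mulrNN mulVf ?scale1r //.
by rewrite vE -!wE e.
Qed.

End FormOf.

Definition is_skewform (w : xi x -> xi x -> lambda x) : Prop :=
  [/\ forall v', linear (fun v => w v v'), forall d v v', w (dact d v) v' = dact d (w v v'),
      forall v v', w v v' = - w v' v & forall v, (forall v', w v v' = 0) -> v = 0].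

Section Polar.
Variables (g : xi x -> xi x -> R) (w : xi x -> xi x -> lambda x).
Hypotheses (hg : hermitian_ip g) (hw : is_skewform w).
Let ig := hg.1.
Let il := cl_ipP lambda x.

Lemma polar_A : exists A, [/\ is_form_of w g A, is_sesqui A, acts_skew g A &
  forall u v, u != 0 -> A u v = 0 -> v = 0].
Proof.
have [wl wd wsk wnd] := hw; have [_ gd] := hg.
have [_ ld] := cl_herm lambda x.
have h u v' : exists a, forall v, <[w v v', u]> = g a v.
  apply: (riesz ig (f := fun v => <[w v v', u]>)) => c v v1.
  by rewrite wl (ip_Dl il) (ip_Zl il).
pose A u v' := projT1 (cid (h u v')).
have AE : is_form_of w g A.
  by move=> v v' u; rewrite /A; case: (cid _) => a /= ->; rewrite (ip_sgC ig).
have wr v c v1 v2 : w v (c *: v1 + v2) = c *: w v v1 + w v v2.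
  by rewrite wsk wl opprD -scalerN -!wsk.
have wdr d v v' : w v (dact d v') = dact d (w v v').
  by rewrite wsk wd (wsk v) dactNr.
have Ad d u v : A (dact d u) v = dact d (A u v).
  apply: (ip_injr ig) => z.
  by rewrite -[RHS]opprK -gd -!AE wd ld opprK.
exists A; split=> //.
- split=> //; [split=> [u|v] c v1 v2|].
  + by apply: (ip_injr ig) => z; rewrite (ip_Dr ig) (ip_Zr ig) -!AE wr (ip_Dl il) (ip_Zl il).
  + by apply: (ip_injr ig) => z; rewrite (ip_Dr ig) (ip_Zr ig) -!AE (ip_Dr il) (ip_Zr il).
  + move=> d u v; apply: (ip_injr ig) => z.
    by rewrite (ip_Nr ig) -Ad -!AE wdr ld.
- by move=> u v v'; rewrite (ip_sgC ig) -!AE wsk (ip_Nl il).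
- move=> u v u0 Auv; apply: wnd => v'; rewrite wsk.
  have e z : w z v = 0.
    apply: (cl_eq0 u0) => [d|]; last by rewrite AE Auv (ip_0r ig).
    by rewrite (ip_sgC il) ld (ip_sgC il) -wd AE Auv (ip_0r ig) oppr0.
  by rewrite e oppr0.
Qed.

(** The form b stands for -A_u^2 / |u|^2, whose square root is the modulus of
    A_u for a unit vector u. *)
Lemma polar_b (A : lambda x -> xi x -> xi x) : is_sesqui A ->
  (forall u v, u != 0 -> A u v = 0 -> v = 0) ->
  exists b : xi x -> xi x -> R, is_ip b /\
    forall u v v', <[u, u]> * b v v' = g (A u v) (A u v').
Proof.
move=> cA inj; have [[lr _] _ _] := cA.
have [u0 u0n] := cl_nonzero lambda x.
have uu := ip_gt0 il u0n; have uun := lt0r_neq0 uu.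
pose b v v' := g (A u0 v) (A u0 v') / <[u0, u0]>; exists b; split.
  split=> [v' c v v1|v v'|v v0]; rewrite /b.
  - by rewrite lr (ip_Dl ig) (ip_Zl ig) mulrDl /GRing.scale /= mulrA.
  - by rewrite (ip_sgC ig).
  - by rewrite divr_gt0 // (ip_gt0 ig) //; apply: contra_neq v0; exact: inj.
move=> u v v'; apply: (mulfI uun); rewrite (conformal u u0 v v' hg cA) /b.
by field.
Qed.

(** Here J = P^-1 A. The modulus P commutes with delta and with every A_u,
    since these commute with S = -A_u^2 / |u|^2; so J_u^2 = P^-2 A_u^2 = -
    |u|^2. *)
Lemma polar_J (A : lambda x -> xi x -> xi x) (b : xi x -> xi x -> R) P :
  is_sesqui A -> acts_skew g A -> is_ip b ->
  (forall u v v', <[u, u]> * b v v' = g (A u v) (A u v')) -> is_sqrt g b P ->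
  let q v v' := g (P v) v' in
  exists J : lambda x -> xi x -> xi x,
    [/\ is_quaternionic J, hermitian_ip q, acts_skew q J &
    forall u v, P (J u v) = A u v].
Proof.
move=> cA sA ib bE sP q; have [[lr ll] Ad Ad'] := cA; have [_ gd] := hg.
have linP := sqrt_linear ig sP.
have iq : is_ip q := sqrt_ip ig ib sP.
have [saP _ hP] := sP.
have Pinj v v' : P v = P v' -> v = v'.
  by move=> e; apply: (ip_inj iq) => z; rewrite /q e.
have [u0 u0n] := cl_nonzero lambda x.
have uun := lt0r_neq0 (ip_gt0 il u0n).
pose S v := - <[u0, u0]>^-1 *: A u0 (A u0 v).
have gS v v' : g (S v) v' = b v v'.
  apply: (mulfI uun); rewrite bE /S (ip_Zl ig) sA; field; exact: uun.
have SE u v : A u (A u v) = - <[u, u]> *: S v.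
  apply: (ip_inj ig) => z; rewrite (ip_Zl ig) gS sA -bE; ring.
have Pd d v : dact d (P v) = P (dact d v).
  apply: (sqrt_comm ig ib sP (dact_linearr d) gS) => z.
  by rewrite /S dactZr Ad' (linearNP (lr u0)) Ad' opprK.
have PA u v : A u (P v) = P (A u v).
  have [->|un] := eqVneq u 0; first by rewrite !(linear0P (ll _)) (linear0P linP).
  apply: (sqrt_comm ig ib sP (lr u) gS) => z.
  have un0 : - <[u, u]> != 0 by rewrite oppr_eq0 lt0r_neq0 // (ip_gt0 il).
  by apply: (scalerI un0); rewrite -(linearZP _ _ (lr u)) -!SE.
have h u v' : exists a, forall v, g v (A u v') = q a v.
  apply: (riesz iq (f := fun v => g v (A u v'))) => c v v1.
  by rewrite (ip_Dl ig) (ip_Zl ig).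
pose J u v' := projT1 (cid (h u v')).
have PJ u v : P (J u v) = A u v.
  by apply: (ip_injr ig) => z; rewrite /J; case: (cid _) => a /= ->; rewrite (ip_sgC ig).
have lJ : Defs.bilinear J.
  split=> [u|v] c v1 v2; apply: Pinj; rewrite linP !PJ; [exact: lr|exact: ll].
have PP v : P (P v) = S v by apply: (ip_inj ig) => z; rewrite gS saP hP.
exists J; split=> //.
- split.
    split=> // d u v; apply: Pinj; first by rewrite -Pd !PJ Ad.
    by rewrite (linearNP linP) -Pd !PJ Ad'.
  move=> u v; have e : P (P (J u (J u v))) = P (P (- <[u, u]> *: v)).
    by rewrite PJ -PA PJ SE !(linearZP _ _ linP) PP.
  exact: Pinj (Pinj _ _ e).
- by split=> // d v v'; rewrite /q -Pd gd.
- by move=> u v v'; rewrite /q PJ sA saP PJ.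
Qed.

End Polar.

End Quaternionic.
End Fibre.

(** * Continuity and homotopy of fibrewise maps *)

Section Total.
Variables (X : choiceType).

Lemma total_cvg (A : fspace X) (S : topologicalType) (f : Defs.total A -> S) :
  continuous f ->
  forall (I : Type) (F : set_system I) (FF : Filter F) (x : I -> X)
    (a : forall i, A (x i)) (x0 : X) (a0 : A x0),
    fpt (a i) @[i --> F] --> fpt a0 ->
    f (existT _ (x i) (a i)) @[i --> F] --> f (existT _ x0 a0).
Proof.
move=> cf I F FF x a x0 a0 ha.
apply: (cvg_comp (fun i => existT _ (x i) (a i) : Defs.total A) f _ (cf _)).
move=> W; rewrite nbhsE => -[B [[C oC <-] /= Bp] sB].
have : F [set i | C (fpt (a i))] by apply: ha; exact: open_nbhs_nbhs.
by apply: (@filterS _ F FF) => i Ci; exact: sB.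
Qed.

Lemma fpt_cvg (A : fspace X) (p0 : Defs.total A) :
  fpt (tagged p) @[p --> p0] --> fpt (tagged p0).
Proof. exact: (initial_continuous (f := fun p : {x : X & A x} => fpt (tagged p))). Qed.

End Total.

Lemma cvg_fst2 (I : Type) (S S' : topologicalType) (F : set_system I) (FF : Filter F)
    (a : I -> S * S') (b : S * S') : a @ F --> b ->
  (a i).1 @[i --> F] --> b.1 /\ (a i).2 @[i --> F] --> b.2.
Proof.
move=> h; split; [apply: (cvg_comp a fst h) | apply: (cvg_comp a snd h)].
  exact: cvg_fst.
exact: cvg_snd.
Qed.

Lemma cvg_pair2 (I : Type) (S S' : topologicalType) (F : set_system I) (FF : Filter F)
    (a : I -> S) (a0 : S) (b : I -> S') (b0 : S') : a @ F --> a0 -> b @ F --> b0 ->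
  (a i, b i) @[i --> F] --> (a0, b0).
Proof. exact: cvg_pair. Qed.

Section Families.
Variables (R : realType) (X : topologicalType).

Lemma fcont_comp (T T' : topologicalType) (E E' : vbundle R X) (S : topologicalType)
    (f : T -> forall x, E x -> E' x -> S) (h : T' -> T) :
  fcont f -> continuous h -> fcont (fun t => f (h t)).
Proof.
move=> cf ch I F FF t t0 x x0 u u0 v v0 ht hu hv; apply: (cf _ _ _ (h \o t)) => //.
exact: (cvg_comp t h ht (ch t0)).
Qed.

Lemma fcont_const (T T' : topologicalType) (E E' : vbundle R X) (S : topologicalType)
    (f : T -> forall x, E x -> E' x -> S) (t0 : T) :
  fcont f -> fcont (fun _ : T' => f t0).
Proof. by move=> cf; apply: fcont_comp => // t; exact: cvg_cst. Qed.

Lemma ip_fcont (E : vbundle R X) (g : inner_product E) (T : topologicalType) :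
  fcont (fun (_ : T) x => ip g (x := x)).
Proof.
move=> I F FF t t0 x x0 u u0 v v0 _ hu hv.
have := @total_cvg X (Defs.fprod E E) _ _ (@ip_continuous _ _ _ g) I F FF x
  (fun i => (u i, v i)) x0 (u0, v0).
by apply; exact: cvg_pair.
Qed.

Lemma cact_cvg (delta : rline R X) (E : Cbundle delta) I (F : set_system I)
    (FF : Filter F) (x : I -> X) (x0 : X) (s : I -> R) (s0 : R)
    (d : forall i, delta (x i)) (d0 : delta x0) (v : forall i, E (x i)) (v0 : E x0) :
  s @ F --> s0 -> vcvg F d d0 -> vcvg F v v0 ->
  vcvg F (fun i => cact ((s i, d i) : Calg delta (x i)) (v i))
    (cact ((s0, d0) : Calg delta x0) v0).
Proof.
move=> hs hd hv; have hx := vcvg_base FF hd.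
have key := @total_cvg X (Defs.fprod (Cfspace delta) E) _ _ (@cact_continuous _ _ _ E) I F FF x
  (fun i => ((s i, d i), v i)) x0 ((s0, d0), v0).
exact: key (cvg_pair2 FF (cvg_pair2 FF (cvg_pair2 FF hx hs) hd) hv).
Qed.

Lemma dact_cvg (delta : rline R X) (E : Cbundle delta) I (F : set_system I)
    (FF : Filter F) (x : I -> X) (x0 : X)
    (d : forall i, delta (x i)) (d0 : delta x0) (v : forall i, E (x i)) (v0 : E x0) :
  vcvg F d d0 -> vcvg F v v0 -> vcvg F (fun i => dact (d i) (v i)) (dact d0 v0).
Proof. by move=> hd hv; apply: cact_cvg => //; exact: cvg_cst. Qed.

(** A form given as a quotient K(b) / |b|^2, the same for all b <> 0, is
    continuous: near a point, let b be a non-vanishing local section. *)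
Lemma fcont_quot (T : topologicalType) (E B : vbundle R X) (m : inner_product B)
    (k : T -> forall x, E x -> E x -> R) (K : T -> forall x, B x -> E x -> E x -> R) :
  (forall x, exists b : B x, b != 0) ->
  (forall t x b v w, ip m b b * k t x v w = K t x b v w) ->
  (forall I (F : set_system I) (FF : Filter F) (t : I -> T) (t0 : T) (x : I -> X) (x0 : X)
    (b : forall i, B (x i)) (b0 : B x0) (v : forall i, E (x i)) (v0 : E x0)
    (w : forall i, E (x i)) (w0 : E x0), t @ F --> t0 -> vcvg F b b0 ->
    vcvg F v v0 -> vcvg F w w0 ->
    K (t i) (x i) (b i) (v i) (w i) @[i --> F] --> K t0 x0 b0 v0 w0) ->
  fcont k.
Proof.
move=> Bn kK cK I F FF t t0 x x0 v v0 w w0 ht hv hw.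
have hx := vcvg_base FF hv; have [b0 b0n] := Bn x0.
have [f fx0] := frame_at B x0.
have hb : vcvg F (fun i => fr_vec f (x i) (fr_coord f b0)) b0.
  by rewrite -{2}(fr_coordK fx0 b0); apply: fr_vec_cvg => //; exact: cvg_cst.
set b := (fun i => _) in hb.
have im y := inner_product_ip m y.
have n0 : ip m b0 b0 != 0 by rewrite lt0r_neq0 // (ip_gt0 (im _)).
have hn : ip m (b i) (b i) @[i --> F] --> ip m b0 b0.
  exact: (@ip_fcont _ m T _ _ _ (fun=> t0) t0 _ _ _ _ _ _ (cvg_cst _) hb hb).
have kE s y (c : B y) u u' : ip m c c != 0 -> k s y u u' = K s y c u u' / ip m c c.
  by move=> c0; rewrite -kK mulrAC mulfV ?mul1r.
rewrite (kE _ _ b0) //.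
have c : K (t i) (x i) (b i) (v i) (w i) / ip m (b i) (b i) @[i --> F]
    --> K t0 x0 b0 v0 w0 / ip m b0 b0.
  by apply: cvgM; [exact: (cK _ _ _ _ _ _ _ _ _ _ _ _ _ ht hb hv hw) | exact: cvgV].
apply: cvg_trans c; apply: near_eq_cvg.
by apply: filterS (cvgr_neq0 _ hn n0) => i hi; rewrite (kE _ _ (b i)).
Qed.

(** A homotopy parametrized by the whole real line, so that no fibre product
    with an interval is needed. Homotopies over [0, 1] extend by clamp. *)
Definition vhomotopic (E E' G : vbundle R X) (P : (forall x, E x -> E' x -> G x) -> Prop)
    (f0 f1 : forall x, E x -> E' x -> G x) : Prop :=
  exists f : R -> forall x, E x -> E' x -> G x,
    [/\ forall t, P (f t), fcont (fun t x u v => vpt (f t x u v) : vtot G),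
        f 0 = f0 & f 1 = f1].

Section Homotopic.
Variables (E E' G : vbundle R X) (P : (forall x, E x -> E' x -> G x) -> Prop).

Lemma vhomotopic_sym f0 f1 : vhomotopic P f0 f1 -> vhomotopic P f1 f0.
Proof.
case=> f [Pf cf f0E f1E]; exists (fun t => f (1 - t)); split=> //.
- apply: (fcont_comp (h := fun t : R => 1 - t) cf) => t.
  by apply: cvgB; [exact: cvg_cst | exact: cvg_id].
- by rewrite subr0.
- by rewrite subrr.
Qed.

(** Run f at double speed, then h. At t = 1/2 both pieces converge to f1, so
    it does not matter which piece a nearby parameter falls in. *)
Lemma vhomotopic_trans f0 f1 f2 :
  vhomotopic P f0 f1 -> vhomotopic P f1 f2 -> vhomotopic P f0 f2.
Proof.
case=> f [Pf cf f0E f1E] [h [Ph ch h1E h2E]].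
pose k t := if t <= 2^-1 then f (2 * t) else h (2 * t - 1).
exists k; split.
- by move=> t; rewrite /k; case: ifP.
- have c2 : continuous (fun t : R => 2 * t).
    by move=> t; apply: cvgM; [exact: cvg_cst | exact: cvg_id].
  have c21 : continuous (fun t : R => 2 * t - 1).
    by move=> t; apply: cvgB; [exact: c2 | exact: cvg_cst].
  have cf' := fcont_comp cf c2; have ch' := fcont_comp ch c21.
  move=> I F FF t t0 x x0 u u0 v v0 ht hu hv.
  have Wf := cf' I F FF t t0 x x0 u u0 v v0 ht hu hv.
  have Wh := ch' I F FF t t0 x x0 u u0 v v0 ht hu hv.
  have [lt|gt|eq] := ltgtP t0 2^-1.
  + rewrite {2}/k ltW //; apply: cvg_trans Wf; apply: near_eq_cvg.
    by apply: filterS (cvgr_lt _ ht _ lt) => i /ltW; rewrite /k => ->.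
  + rewrite {2}/k leNgt gt; apply: cvg_trans Wh; apply: near_eq_cvg.
    by apply: filterS (cvgr_gt _ ht _ gt) => i; rewrite /k leNgt => ->.
  + have e : 2 * t0 = 1 by rewrite eq mulfV.
    have e' : 2 * t0 - 1 = 0 by rewrite e subrr.
    rewrite {2}/k eq lexx -eq e f1E => W nW.
    rewrite e f1E in Wf; rewrite e' h1E in Wh.
    apply: (@filterS2 _ F FF _ _ _ _ (Wf W nW) (Wh W nW)) => i Wi Wi'.
    by rewrite /= /k; case: ifP.
- by rewrite /k mulr0 invr_ge0 ler0n.
- rewrite /k; have -> : (1 : R) <= 2^-1 = false by lra.
  by have -> : 2 * 1 - 1 = 1 :> R by ring.
Qed.

End Homotopic.

End Families.

(** * Structures and forms as continuous families of maps *)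

Section Clamp.
Variable R : realType.

Definition clamp (t : R) : R := Num.max 0 (Num.min t 1).

Lemma clamp01 t : 0 <= clamp t <= 1.
Proof. by rewrite /clamp le_max lexx /= ge_max ler01 /= ge_min lexx orbT. Qed.

Lemma clamp_id t : 0 <= t <= 1 -> clamp t = t.
Proof. by move=> /andP[t0 t1]; rewrite /clamp min_l // max_r. Qed.

Lemma clamp_continuous : continuous clamp.
Proof.
move=> t.
have e s : clamp s = (`|s| - `|s - 1| + 1) / 2.
  rewrite /clamp; have [s0|s0] := leP s 0.
    have s1 : s <= 1 by lra.
    rewrite min_l // max_l // ler0_norm // ler0_norm ?subr_le0 //; lra.
  have [s1|s1] := leP s 1.
    rewrite ?min_l // max_r ?ltW // gtr0_norm // ler0_norm ?subr_le0 //; lra.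
  rewrite ?min_r ?ltW // max_r ?ler01 // gtr0_norm // gtr0_norm ?subr_gt0 //; lra.
rewrite [clamp](_ : _ = fun s => (`|s| - `|s - 1| + 1) / 2); last exact/funext.
apply: cvgM; last exact: cvg_cst.
apply: cvgD; last exact: cvg_cst.
apply: cvgB; first by apply: (@cvg_norm _ R^o); exact: cvg_id.
by apply: (@cvg_norm _ R^o); apply: cvgB; [exact: cvg_id | exact: cvg_cst].
Qed.

End Clamp.

Section Structures.
Variables (R : realType) (X : topologicalType) (delta : rline R X).
Variables (lambda : Cline delta) (xi : Cbundle delta).
Local Notation "<[ u , v ]>" := (ip (cl_ip lambda) u v).
Local Notation Jmap := (forall x : X, lambda x -> xi x -> xi x).
Local Notation wmap := (forall x : X, xi x -> xi x -> lambda x).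
Local Notation qmap := (forall x : X, xi x -> xi x -> R).

Definition Jcont (T : topologicalType) (J : T -> Jmap) : Prop :=
  fcont (fun t x u v => vpt (J t x u v) : vtot xi).
Definition wcont (T : topologicalType) (w : T -> wmap) : Prop :=
  fcont (fun t x u v => vpt (w t x u v) : vtot lambda).

Definition jmap (H : Hstructure lambda xi) : Jmap :=
  fun x u v => H x ((0, (0, u)) : Halg lambda x) v.

Lemma hactE (H : Hstructure lambda xi) x (a : Halg lambda x) v :
  H x a v = cact ((a.1, a.2.1) : Calg delta x) v + jmap H a.2.2 v.
Proof.
have [[_ hl] _ _] := hact_module H x.
rewrite -(hact_extends H) /jmap -(linearDP (hl v)); congr (hact _ _ _).
by case: a => s [d u]; congr (_, (_, _)); rewrite /= ?addr0 ?add0r.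
Qed.

Lemma Hstructure_ext (H H' : Hstructure lambda xi) :
  (forall x u v, jmap H u v = jmap H' u v :> xi x) -> H = H'.
Proof.
move=> e; have : hact H = hact H'.
  apply: functional_extensionality_dep => x; apply/funext => a; apply/funext => v.
  by rewrite !hactE e.
case: H H' {e} => h m ex c [h' m' ex' c'] /= hh; subst h'.
by congr HStructure; exact: Prop_irrelevance.
Qed.

Lemma jmap_quaternionic (H : Hstructure lambda xi) x : is_quaternionic (jmap H (x := x)).
Proof.
have [[hr hl] one mul] := hact_module H x.
have dE d v : dact d v = H x ((0, (d, 0)) : Halg lambda x) v.
  by rewrite /dact -(hact_extends H).
have id_ := inner_product_ip (rl_ip delta) x; have il := cl_ipP lambda x.
have w0 (u : lambda x) : wedge 0 u = 0 :> delta x.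
  apply: (ip_inj id_) => e.
  by rewrite wedgeP dact0r (ip_0l il) (ip_0l id_).
split; first split.
- split=> [u|v] a v1 v2; first exact: hr.
  rewrite /jmap -hl; congr (hact _ _ _); congr (_, (_, _)) => /=.
    by rewrite scaler0 addr0.
  by rewrite scaler0 addr0.
- move=> d u v; rewrite dE /jmap -mul; congr (hact _ _ _).
  rewrite /Hmul /qmul /dl_ip /dl_cross /= ?(ip_0l id_) ?(ip_0r id_) ?(ip_0l il) ?wedge0 ?w0.
  by rewrite mulr0 addr0 subr0 !scale0r ?add0r ?addr0 ?dact0l ?subr0.
- move=> d u v; rewrite !dE /jmap -!mul -(linearNP (hl v)); congr (hact _ _ _).
  rewrite /Hmul /qmul /dl_ip /dl_cross /= ?(ip_0l id_) ?(ip_0r id_) ?(ip_0l il) ?(ip_0r il).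
  rewrite wedge0 w0 mulr0 addr0 subr0 !scale0r !add0r !dact0l subr0 sub0r.
  have -> : - ((0, (0, dact d u)) : Halg lambda x) = (- 0, (- 0, - dact d u)) by [].
  by rewrite !oppr0.
- move=> u v; have wuu : wedge u u = 0 :> delta x.
    apply: (ip_inj id_) => e; rewrite wedgeP (ip_0l id_).
    by have [_ h] := cl_herm lambda x; have := h e u u; rewrite (ip_sgC il u); lra.
  have -> : - <[u, u]> *: v = H x (C_in_H lambda ((- <[u, u]>, 0) : Calg delta x)) v.
    by rewrite hact_extends cactE /= dact0l addr0.
  rewrite /jmap -mul; congr (hact _ _ _).
  rewrite /Hmul /qmul /dl_ip /dl_cross /= !(ip_0l id_) wuu.
  by rewrite mulr0 sub0r add0r !scale0r !add0r !dact0l subr0.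
Qed.

Lemma jmap_cont (T : topologicalType) (K : T -> Hstructure lambda xi) :
  (forall I (F : set_system I) (FF : Filter F) (t : I -> T) (t0 : T) (x : I -> X) (x0 : X)
    (a : forall i, Hfspace lambda (x i)) (a0 : Hfspace lambda x0)
    (v : forall i, xi (x i)) (v0 : xi x0), t @ F --> t0 ->
    fpt (a i) @[i --> F] --> fpt a0 -> vcvg F v v0 ->
    vcvg F (fun i => K (t i) (x i) (a i) (v i)) (K t0 x0 a0 v0)) ->
  Jcont (fun t => jmap (K t)).
Proof.
move=> cK I F FF t t0 x x0 u u0 v v0 ht hu hv.
have hx := vcvg_base FF hu.
apply: (cK _ F FF t t0 x x0 (fun i => (0, (0, u i)) : Hfspace lambda (x i))
  ((0, (0, u0)) : Hfspace lambda x0)) => //.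
have c0 : (fun=> 0 : R) @ F --> (0 : R) by exact: cvg_cst.
exact: (cvg_pair2 FF (cvg_pair2 FF hx c0) (cvg_pair2 FF (vcvg0 (E := delta) FF hx) hu)).
Qed.

Lemma jmap_cont1 (H : Hstructure lambda xi) (T : topologicalType) :
  Jcont (fun _ : T => jmap H).
Proof.
apply: (@jmap_cont T (fun=> H)) => I F FF t t0 x x0 a a0 v v0 _ ha hv.
have key := @total_cvg X (Defs.fprod (Hfspace lambda) xi) _ _ (@hact_continuous _ _ _ _ _ H)
  I F FF x (fun i => (a i, v i)) x0 (a0, v0).
exact: key (cvg_pair2 FF ha hv).
Qed.

Section Build.
Variable J : Jmap.
Hypotheses (qJ : forall x, is_quaternionic (@J x))
  (cJ : forall T : topologicalType, Jcont (fun _ : T => J)).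

Let h x (a : Halg lambda x) (v : xi x) : xi x :=
  cact ((a.1, a.2.1) : Calg delta x) v + @J x a.2.2 v.

Let h_module x : is_module (@Hmul R X delta lambda x) (Hone lambda x) (h (x := x)).
Proof.
have [[[lr ll] Jd Jd'] JJ] := qJ x.
split.
- split=> [a|v] c v1 v2.
    by rewrite /h cact_linearr lr scalerDr addrACA.
  by rewrite /h /= ll scalerDr addrACA -cact_linearl.
- move=> v; rewrite /h cactE /= (linear0P (ll v)) scale1r.
  by rewrite (dact0l _) !addr0.
- move=> a b v; rewrite /h !cactE /=.
  rewrite /dl_ip /= !dactDl !dactZl !dactDr !dactZr !dactK.
  rewrite !(linearDP (lr _)) !(linearDP (ll _)) !(linearZP _ _ (lr _)) !(linearZP _ _ (ll _)).
  rewrite !(linearNP (ll _)) Jd' (quat_mul _ _ _ (qJ x)).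
  rewrite !Jd scalerBl scalerDl opprD !scalerDr scalerA !scaleNr !addrA.
  (* Both sides are now sums of the same ten terms. *)
  by rewrite [LHS](ACl (1*4*7*5*2*9*8*10*3*6)%AC).
Qed.

Let h_extends x (z : Calg delta x) (v : xi x) : h (C_in_H lambda z) v = cact z v.
Proof.
have [[[_ ll] _ _] _] := qJ x.
by rewrite /h /C_in_H /= (linear0P (ll v)) addr0; case: z.
Qed.

Lemma hcont I (F : set_system I) (FF : Filter F) (x : I -> X) (x0 : X)
    (a : forall i, Hfspace lambda (x i)) (a0 : Hfspace lambda x0)
    (v : forall i, xi (x i)) (v0 : xi x0) :
  fpt (a i) @[i --> F] --> fpt a0 -> vcvg F v v0 ->
  vcvg F (fun i => h (a i : Halg lambda (x i)) (v i)) (h (a0 : Halg lambda x0) v0).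
Proof.
move=> ha hv; rewrite /h.
have [h1 h2] := cvg_fst2 FF ha; have [_ h3] := cvg_fst2 FF h1.
have [h4 h5] := cvg_fst2 FF h2.
apply: vcvgD => //; first exact: cact_cvg.
apply: (@cJ X _ F FF (fun=> x0) x0) => //; exact: cvg_cst.
Qed.

Let h_continuous : continuous (fun p : Defs.total (Defs.fprod (Hfspace lambda) xi) =>
    vpt (h (x := tag p) (tagged p).1 (tagged p).2) : vtot xi).
Proof.
move=> p0; have [ha hv] := cvg_fst2 (@nbhs_filter _ p0) (@fpt_cvg X _ p0).
exact: (@hcont _ (nbhs p0) (@nbhs_filter _ p0) _ _ _ _ _ _ ha hv).
Qed.

Definition Hbuild : Hstructure lambda xi :=
  HStructure h_module h_extends h_continuous.

Lemma jmap_build x (u : lambda x) (v : xi x) : jmap Hbuild u v = @J x u v.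
Proof. by rewrite /jmap /= /h cactE /= scale0r dact0l addr0 add0r. Qed.

End Build.

Definition is_nsform (x : X) (w : xi x -> xi x -> lambda x) : Prop :=
  [/\ forall u, Clinear (w u), forall v, Clinear (fun u => w u v),
      forall u v, w u v = - w v u &
      forall f : xi x -> lambda x, Clinear f -> exists! u, w u = f].

Lemma nsform_skewform x (w : xi x -> xi x -> lambda x) : is_nsform w -> is_skewform w.
Proof.
case=> wr wl sk ns; split=> //.
- move=> v' a u v; have [wD wC] := wl v'; rewrite wD; congr (_ + _).
  by have := wC (a, 0) u; rewrite !cactE /= !dact0l !addr0.
- move=> d v v'; have [_ wC] := wl v'.
  by have := wC (0, d) v; rewrite !cactE /= !scale0r !add0r.
- move=> v v0; have [|u [_ uu]] := ns (fun=> 0).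
    by split=> [a b|z a]; rewrite ?addr0 // cactE scaler0 dact0r addr0.
  have w0 : w 0 = fun=> 0.
    apply/funext => z; have [wD _] := wl z.
    by apply: (@addrI _ (w 0 z)); rewrite -wD !addr0.
  rewrite -(uu v) ?(uu 0) //; exact/funext.
Qed.

Lemma form_nsform (w : skewform lambda xi) x : is_nsform (Defs.form w (x := x)).
Proof.
split; [exact: form_Clinear_r | exact: form_Clinear_l | exact: form_skew |].
exact: form_nonsingular.
Qed.

Lemma form_ext (w w' : skewform lambda xi) :
  (forall x u v, Defs.form w u v = Defs.form w' u v :> lambda x) -> w = w'.
Proof.
move=> e; have : Defs.form w = Defs.form w'.
  apply: functional_extensionality_dep => x; apply/funext => a; apply/funext => v.
  exact: e.
case: w w' {e} => h ? ? ? ? ? [h' ? ? ? ? ?] /= hh; subst h'.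
by congr SkewForm; exact: Prop_irrelevance.
Qed.

Lemma form_cont1 (w : skewform lambda xi) (T : topologicalType) :
  wcont (fun _ : T => Defs.form w).
Proof.
move=> I F FF t t0 x x0 u u0 v v0 _ hu hv.
have key := @total_cvg X (Defs.fprod xi xi) _ _ (@form_continuous _ _ _ _ _ w)
  I F FF x (fun i => (u i, v i)) x0 (u0, v0).
exact: key (cvg_pair2 FF hu hv).
Qed.

Section BuildForm.
Variable w : wmap.
Hypotheses (nw : forall x, is_nsform (@w x))
  (cw : forall T : topologicalType, wcont (fun _ : T => w)).

Let w_continuous : continuous (fun p : Defs.total (Defs.fprod xi xi) =>
    vpt (w (tagged p).1 (tagged p).2) : vtot lambda).
Proof.
move=> p0; have [ha hv] := cvg_fst2 (@nbhs_filter _ p0) (@fpt_cvg X _ p0).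
apply: (@cw X _ (nbhs p0) (@nbhs_filter _ p0) (fun=> tag p0) (tag p0) _ _ _ _ _ _ _ ha hv).
exact: cvg_cst.
Qed.

Definition form_build : skewform lambda xi.
Proof.
apply: (@SkewForm R X delta lambda xi w _ _ _ _ w_continuous) => x.
- by have [] := nw x.
- by have [] := nw x.
- by have [] := nw x.
- by have [] := nw x.
Defined.

End BuildForm.

Lemma Hhomotopic_maps (H0 H1 : Hstructure lambda xi) :
  Hhomotopic H0 H1 <->
  vhomotopic (fun J : Jmap => forall x, is_quaternionic (@J x)) (jmap H0) (jmap H1).
Proof.
split.
  case=> K [K0 K1 cK]; exists (fun t => jmap (K (clamp t))); split.
  - by move=> t x; exact: jmap_quaternionic.
  - apply: (@jmap_cont R (fun t => K (clamp t))) => I F FF t t0 x x0 a a0 v v0 ht ha hv.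
    have hx := vcvg_base FF hv.
    have key := @total_cvg X (Defs.fprod (fcyl R X) (Defs.fprod (Hfspace lambda) xi))
      _ _ cK I F FF x
      (fun i => (exist _ (clamp (t i)) (clamp01 (t i)), (a i, v i))) x0
      (exist _ (clamp t0) (clamp01 t0), (a0, v0)).
    have hc : clamp (t i) @[i --> F] --> clamp t0.
      exact: (cvg_comp t (@clamp R) ht (@clamp_continuous R t0)).
    exact: key (cvg_pair2 FF (cvg_pair2 FF hx hc) (cvg_pair2 FF ha hv)).
  - by rewrite clamp_id ?K0 // lexx ler01.
  - by rewrite clamp_id ?K1 // lexx ler01.
case=> J [qJ cJ J0 J1].
have cJt t : forall T : topologicalType, Jcont (fun _ : T => J t).
  by move=> T; exact: (@fcont_const R X R T lambda xi (vtot xi) _ t cJ).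
exists (fun t => Hbuild (qJ t) (cJt t)); split.
- by apply: Hstructure_ext => x u v; rewrite jmap_build J0.
- by apply: Hstructure_ext => x u v; rewrite jmap_build J1.
- move=> p0; have [h1 h2] := cvg_fst2 (@nbhs_filter _ p0) (@fpt_cvg X _ p0).
  have [_ ht] := cvg_fst2 (@nbhs_filter _ p0) h1.
  have [ha hv] := cvg_fst2 (@nbhs_filter _ p0) h2.
  have [ha1 ha2] := cvg_fst2 (@nbhs_filter _ p0) ha.
  have [_ hs] := cvg_fst2 (@nbhs_filter _ p0) ha1.
  have [hd hl] := cvg_fst2 (@nbhs_filter _ p0) ha2.
  apply: (vcvgD (@nbhs_filter _ p0)).
    exact: (cact_cvg (@nbhs_filter _ p0) hs hd hv).
  exact: (cJ _ (nbhs p0) (@nbhs_filter _ p0) _ _ _ _ _ _ _ _ ht hl hv).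
Qed.

Lemma form_homotopic_maps (w0 w1 : skewform lambda xi) :
  form_homotopic w0 w1 <-> vhomotopic (fun w : wmap => forall x, is_nsform (@w x))
    (Defs.form w0) (Defs.form w1).
Proof.
split.
  case=> w [e0 e1 cw]; exists (fun t => Defs.form (w (clamp t))); split.
  - by move=> t x; exact: form_nsform.
  - move=> I F FF t t0 x x0 u u0 v v0 ht hu hv.
    have hx := vcvg_base FF hv.
    have key := @total_cvg X (Defs.fprod (fcyl R X) (Defs.fprod xi xi))
      _ _ cw I F FF x
      (fun i => (exist _ (clamp (t i)) (clamp01 (t i)), (u i, v i))) x0
      (exist _ (clamp t0) (clamp01 t0), (u0, v0)).
    have hc : clamp (t i) @[i --> F] --> clamp t0.
      exact: (cvg_comp t (@clamp R) ht (@clamp_continuous R t0)).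
    exact: key (cvg_pair2 FF (cvg_pair2 FF hx hc) (cvg_pair2 FF hu hv)).
  - by rewrite clamp_id ?e0 // lexx ler01.
  - by rewrite clamp_id ?e1 // lexx ler01.
case=> w [nw cw e0 e1].
have cwt t : forall T : topologicalType, wcont (fun _ : T => w t).
  by move=> T; exact: (@fcont_const R X R T xi xi (vtot lambda) _ t cw).
exists (fun t => form_build (nw t) (cwt t)); split.
- by apply: form_ext => x u v; rewrite /= e0.
- by apply: form_ext => x u v; rewrite /= e1.
- move=> p0; have [h1 h2] := cvg_fst2 (@nbhs_filter _ p0) (@fpt_cvg X _ p0).
  have [_ ht] := cvg_fst2 (@nbhs_filter _ p0) h1.
  have [hu hv] := cvg_fst2 (@nbhs_filter _ p0) h2.
  exact: (cw _ (nbhs p0) (@nbhs_filter _ p0) _ _ _ _ _ _ _ _ ht hu hv).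
Qed.

End Structures.

(** * The correspondence over a base *)

Lemma dchoice2 (T X : Type) (C : X -> Type) (P : T -> forall x, C x -> Prop) :
  (forall t x, exists a, P t x a) -> exists f : T -> forall x, C x, forall t x, P t x (f t x).
Proof.
move=> h; exists (fun t x => projT1 (cid (h t x))) => t x.
exact: projT2 (cid (h t x)).
Qed.

Section Correspondence.
Variables (R : realType) (X : topologicalType) (delta : rline R X).
Variables (lambda : Cline delta) (xi : Cbundle delta).
Local Notation "<[ u , v ]>" := (ip (cl_ip lambda) u v).
Local Notation Jmap := (forall x : X, lambda x -> xi x -> xi x).
Local Notation wmap := (forall x : X, xi x -> xi x -> lambda x).
Local Notation qmap := (forall x : X, xi x -> xi x -> R).

Lemma herm_exists : compact [set: X] -> hausdorff_space X ->
  exists g : qmap, (forall x, hermitian_ip (@g x)) /\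
    forall T : topologicalType, fcont (fun _ : T => g).
Proof.
move=> cX hX; have [g0 [ig0 cg0]] := metric_exists xi cX hX.
have [h hh] := dchoice2 (fun (_ : unit) x => herm_avg (ig0 x)).
exists (h tt); split=> [x|T]; first by have [] := hh tt x.
apply: (@fcont_quot _ _ _ _ _ (rl_ip delta) _
  (fun _ x d v w => ip (rl_ip delta) d d * g0 x v w + g0 x (dact d v) (dact d w))).
- by move=> x; exists (vpick fullv); rewrite vpick0 -dimv_eq0 rl_dim.
- by move=> _ x d v w; have [_ ->] := hh tt x.
- move=> I F FF t t0 x x0 d d0 v v0 w w0 ht hd hv hw.
  apply: cvgD.
    apply: cvgM; first exact: (@ip_fcont _ _ _ (rl_ip delta) T _ F FF t t0).
    exact: (cg0 T _ F FF t t0).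
  by apply: (cg0 T _ F FF t t0) => //; exact: dact_cvg.
Qed.

Section Family.
Variable T : topologicalType.

(** The last clause keeps the endpoints of a path of metrics fixed: a metric
    that is already invariant is its own average. *)
Lemma quat_avg_family (g : T -> qmap) (J : T -> Jmap) :
  (forall t x, hermitian_ip (g t x)) -> fcont g ->
  (forall t x, is_quaternionic (J t x)) -> Jcont J ->
  exists q : T -> qmap, [/\ forall t x, hermitian_ip (q t x),
    forall t x, acts_skew (q t x) (J t x), fcont q &
    forall t, (forall x, acts_skew (g t x) (J t x)) -> q t = g t].
Proof.
move=> hg cg qJ cJ.
have [q hq] := dchoice2 (fun t x => quat_avg (hg t x) (qJ t x)).
exists q; split=> [t x|t x||t sk]; [by have [] := hq t x | by have [] := hq t x | |].
  apply: (@fcont_quot _ _ _ _ _ (cl_ip lambda) _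
    (fun t x u v w => 2^-1 * (<[u, u]> * g t x v w + g t x (J t x u v) (J t x u w)))).
  - by move=> x; exact: cl_nonzero.
  - by move=> t x u v w; have [_ _ ->] := hq t x.
  - move=> I F FF t t0 x x0 u u0 v v0 w w0 ht hu hv hw.
    have hJv := cJ _ F FF _ _ _ _ _ _ _ _ ht hu hv.
    have hJw := cJ _ F FF _ _ _ _ _ _ _ _ ht hu hw.
    apply: cvgM; first exact: cvg_cst.
    apply: cvgD; last exact: (cg _ F FF _ _ _ _ _ _ _ _ ht hJv hJw).
    apply: cvgM; last exact: (cg _ F FF _ _ _ _ _ _ _ _ ht hv hw).
    exact: (@ip_fcont _ _ _ (cl_ip lambda) T _ F FF t t0).
apply: functional_extensionality_dep => x; apply/funext => v; apply/funext => w.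
have [u u0] := cl_nonzero lambda x; have [_ _ e] := hq t x.
have uu := lt0r_neq0 (ip_gt0 (cl_ipP lambda x) u0).
apply: (mulfI uu); have [_ JJ] := qJ t x.
rewrite (e u v w) sk JJ (ip_Zr (hg t x).1); by field.
Qed.

Lemma form_of_family (q : T -> qmap) (J : T -> Jmap) :
  (forall t x, hermitian_ip (q t x)) -> fcont q ->
  (forall t x, is_quaternionic (J t x)) -> Jcont J -> (forall t x, acts_skew (q t x) (J t x)) ->
  exists w : T -> wmap, [/\ forall t x, is_form_of (w t x) (q t x) (J t x),
    forall t x, is_nsform (w t x) & wcont w].
Proof.
move=> hq cq qJ cJ sk.
have [w hw] := dchoice2 (fun t x => form_of_exists (hq t x).1 (qJ t x).1).
exists w; split=> // [t x|].
  split.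
  - exact: form_of_Clinearr (hq t x) (qJ t x) (sk t x) (hw t x).
  - exact: form_of_Clinearl (hq t x) (qJ t x) (hw t x).
  - exact: form_of_skew (hq t x) (sk t x) (hw t x).
  - exact: form_of_nonsingular (hq t x) (qJ t x) (sk t x) (hw t x).
move=> I F FF t t0 x x0 u u0 v v0 ht hu hv.
have hx := vcvg_base FF hu.
apply: (@vcvg_ip R X T lambda (fun _ x => ip (cl_ip lambda) (x := x)) _ _ I F FF t t0 x x0) => //.
- by move=> _ y; exact: cl_ipP.
- exact: ip_fcont.
move=> z z0 hz; rewrite hw.
have -> : (fun i => <[w (t i) (x i) (u i) (v i), z i]>)
    = (fun i => q (t i) (x i) (u i) (J (t i) (x i) (z i) (v i))).
  by apply/funext => i; rewrite hw.
have hJ := cJ _ F FF _ _ _ _ _ _ _ _ ht hz hv.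
exact: (cq _ F FF _ _ _ _ _ _ _ _ ht hu hJ).
Qed.

(** The last clause recovers a structure from its own form: when J0 acts by
    g-skew operators and w is its form through g, the uniqueness of square
    roots makes the modulus the identity. *)
Lemma polar_family (g : T -> qmap) (w : T -> wmap) :
  (forall t x, hermitian_ip (g t x)) -> fcont g ->
  (forall t x, is_nsform (w t x)) -> wcont w ->
  exists (J : T -> Jmap) (q : T -> qmap), [/\ forall t x, is_quaternionic (J t x), Jcont J,
    [/\ forall t x, hermitian_ip (q t x), fcont q, forall t x, acts_skew (q t x) (J t x) &
        forall t x, is_form_of (w t x) (q t x) (J t x)] &
    forall t (J0 : Jmap), (forall x, is_quaternionic (@J0 x)) ->
      (forall x, acts_skew (g t x) (@J0 x)) ->
      (forall x, is_form_of (w t x) (g t x) (@J0 x)) -> J t = J0].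
Proof.
move=> hg cg nw cw.
have sw t x : is_skewform (w t x) := nsform_skewform (nw t x).
have [A hA] := dchoice2 (fun t x => polar_A (hg t x) (sw t x)).
have AE t x : is_form_of (w t x) (g t x) (A t x) by have [] := hA t x.
have cA t x : is_sesqui (A t x) by have [] := hA t x.
have sA t x : acts_skew (g t x) (A t x) by have [] := hA t x.
have Ai t x u v : u != 0 -> A t x u v = 0 -> v = 0.
  by have [_ _ _ h] := hA t x; exact: h.
have [b hb] := dchoice2 (fun t x => polar_b (hg t x) (cA t x) (@Ai t x)).
have ib t x : is_ip (b t x) by have [] := hb t x.
have bE t x u v v' : <[u, u]> * b t x v v' = g t x (A t x u v) (A t x u v').
  by have [_ ->] := hb t x.
have ig t x := (hg t x).1.
have [P sP] : exists P : T -> forall x, xi x -> xi x,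
    forall t x, is_sqrt (g t x) (b t x) (P t x).
  apply: (@dchoice2 T X (fun x => xi x -> xi x) (fun t x P => is_sqrt (g t x) (b t x) P)) => t x.
  by have [P [_ sP _ _]] := sqrt_exists (ig t x) (ib t x); exists P.
have [J hJ] := dchoice2 (fun t x =>
  polar_J (hg t x) (cA t x) (sA t x) (ib t x) (bE t x) (sP t x)).
pose q t x (v v' : xi x) := g t x (P t x v) v'.
have qJ t x : is_quaternionic (J t x) by have [] := hJ t x.
have hq t x : hermitian_ip (q t x) by have [] := hJ t x.
have PJ t x u v : P t x (J t x u v) = A t x u v by have [_ _ _ ->] := hJ t x.
have wE t x : is_form_of (w t x) (q t x) (J t x).
  by move=> v v' u; rewrite AE /q; have [saP _ _] := sP t x; rewrite saP PJ.
have contA : Jcont A.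
  move=> I F FF t t0 x x0 u u0 v v0 ht hu hv; have hx := vcvg_base FF hu.
  apply: (@vcvg_ip R X T xi g ig cg I F FF t t0 x x0) => // z z0 hz.
  rewrite (ip_sgC (ig _ _)) -AE.
  have -> : (fun i => g (t i) (x i) (A (t i) (x i) (u i) (v i)) (z i))
    = (fun i => <[w (t i) (x i) (z i) (v i), u i]>).
    by apply/funext => i; rewrite AE (ip_sgC (ig _ _)).
  have hw := cw _ F FF _ _ _ _ _ _ _ _ ht hz hv.
  exact: (@ip_fcont _ _ _ (cl_ip lambda) T _ F FF t t0).
have contb : fcont b.
  apply: (@fcont_quot _ _ _ _ _ (cl_ip lambda) _
    (fun t x u v v' => g t x (A t x u v) (A t x u v'))).
  - by move=> x; exact: cl_nonzero.
  - exact: bE.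
  - move=> I F FF t t0 x x0 u u0 v v0 v' v'0 ht hu hv hv'.
    have h1 := contA _ F FF _ _ _ _ _ _ _ _ ht hu hv.
    have h2 := contA _ F FF _ _ _ _ _ _ _ _ ht hu hv'.
    exact: (cg _ F FF _ _ _ _ _ _ _ _ ht h1 h2).
have contq : fcont q := sqrt_fcont ig ib cg contb sP.
exists J, q; split=> //.
- move=> I F FF t t0 x x0 u u0 v v0 ht hu hv; have hx := vcvg_base FF hu.
  apply: (@vcvg_ip R X T xi q (fun t x => (hq t x).1) contq I F FF t t0 x x0) => // z z0 hz.
  rewrite (ip_sgC (hq _ _).1) -wE.
  have -> : (fun i => q (t i) (x i) (J (t i) (x i) (u i) (v i)) (z i))
    = (fun i => <[w (t i) (x i) (z i) (v i), u i]>).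
    by apply/funext => i; rewrite wE (ip_sgC (hq _ _).1).
  have hw := cw _ F FF _ _ _ _ _ _ _ _ ht hz hv.
  exact: (@ip_fcont _ _ _ (cl_ip lambda) T _ F FF t t0).
- by split=> // t x; have [] := hJ t x.
- move=> t J0 qJ0 sJ0 wJ0; apply: functional_extensionality_dep => x.
  have [u0 u0n] := cl_nonzero lambda x.
  have uu := lt0r_neq0 (ip_gt0 (cl_ipP lambda x) u0n).
  have AJ u v : A t x u v = J0 x u v.
    by apply: (ip_injr (ig t x)) => z; rewrite -AE wJ0.
  have bg v v' : b t x v v' = g t x v v'.
    apply: (mulfI uu); rewrite bE !AJ sJ0 (qJ0 x).2 (ip_Zr (ig _ _)); ring.
  have Pid : P t x = id.
    apply: (sqrt_unique (ig t x) (ib t x) (sP t x)).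
    by split=> // v; exact: (ip_ge0 (ig t x)).
  by apply/funext => u; apply/funext => v; rewrite -AJ -PJ Pid.
Qed.

End Family.

(** A structure has many forms, one for each invariant metric;
    corresponds_forms shows that they are homotopic. *)
Definition corresponds (J : Jmap) (w : wmap) : Prop :=
  exists q : qmap, [/\ forall x, hermitian_ip (@q x),
    forall T : topologicalType, fcont (fun _ : T => q),
    forall x, acts_skew (@q x) (@J x) & forall x, is_form_of (@w x) (@q x) (@J x)].

Local Notation Jhomotopic := (vhomotopic (fun J : Jmap => forall x, is_quaternionic (@J x))).
Local Notation whomotopic := (vhomotopic (fun w : wmap => forall x, is_nsform (@w x))).

(** The segment joining two metrics, with its parameter clamped to stay in the
    convex set of hermitian metrics. *)
Lemma metric_path (q0 q1 : qmap) :
  (forall x, hermitian_ip (@q0 x)) -> (forall x, hermitian_ip (@q1 x)) ->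
  (forall T : topologicalType, fcont (fun _ : T => q0)) ->
  (forall T : topologicalType, fcont (fun _ : T => q1)) ->
  exists g : R -> qmap, [/\ forall t x, hermitian_ip (g t x), fcont g, g 0 = q0 & g 1 = q1].
Proof.
move=> h0 h1 c0 c1.
exists (fun t x v v' => (1 - clamp t) * q0 x v v' + clamp t * q1 x v v'); split.
- move=> t x; have [i0 d0] := h0 x; have [i1 d1] := h1 x.
  have /andP[t0 t1] := clamp01 t.
  split; last by move=> d v v'; rewrite d0 d1; ring.
  split=> [v a u u'|u v|u un].
  + by rewrite !(ip_Dl i0) !(ip_Zl i0) !(ip_Dl i1) !(ip_Zl i1) /GRing.scale /=; ring.
  + by rewrite (ip_sgC i0) (ip_sgC i1).
  + have p0 := ip_gt0 i0 un; have p1 := ip_gt0 i1 un.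
    have [e|n] := eqVneq (clamp t) 0.
      by rewrite e subr0 mul1r mul0r addr0.
    have c : 0 < clamp t by rewrite lt_neqAle eq_sym n.
    by rewrite ltr_wpDl ?mulr_gt0 // mulr_ge0 ?subr_ge0 // ltW.
- move=> I F FF t t0 x x0 u u0 v v0 ht hu hv.
  have hc : clamp (t i) @[i --> F] --> clamp t0.
    exact: (cvg_comp t (@clamp R) ht (@clamp_continuous R t0)).
  apply: cvgD; apply: cvgM => //.
  + by apply: cvgB => //; exact: cvg_cst.
  + exact: (c0 R _ F FF t t0).
  + exact: (c1 R _ F FF t t0).
- apply: functional_extensionality_dep => x; apply/funext => u; apply/funext => v.
  by rewrite clamp_id ?lexx ?ler01 // subr0 mul1r mul0r addr0.
- apply: functional_extensionality_dep => x; apply/funext => u; apply/funext => v.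
  by rewrite clamp_id ?lexx ?ler01 // subrr mul1r mul0r add0r.
Qed.

Lemma form_of_inj (q : qmap) (J : Jmap) (w w' : wmap) :
  (forall x, is_form_of (@w x) (@q x) (@J x)) ->
  (forall x, is_form_of (@w' x) (@q x) (@J x)) -> w = w'.
Proof.
move=> h h'; apply: functional_extensionality_dep => x.
apply/funext => u; apply/funext => v.
by apply: (ip_inj (cl_ipP lambda x)) => z; rewrite h h'.
Qed.

Lemma corresponds_forms J0 J1 w0 w1 : corresponds J0 w0 -> corresponds J1 w1 ->
  Jhomotopic J0 J1 -> whomotopic w0 w1.
Proof.
move=> [q0 [h0 c0 s0 e0]] [q1 [h1 c1 s1 e1]] [J [qJ cJ J0E J1E]].
have [g [hg cg g0 g1]] := metric_path h0 h1 c0 c1.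
have [q [hq sq cq qg]] := quat_avg_family hg cg qJ cJ.
have [w [we nw cw]] := form_of_family hq cq qJ cJ sq.
have q0E : q 0 = q0 by rewrite qg g0 // J0E.
have q1E : q 1 = q1 by rewrite qg g1 // J1E.
exists w; split=> //.
- by apply: (form_of_inj (q := q0) (J := J0)) => // x; rewrite -q0E -J0E.
- by apply: (form_of_inj (q := q1) (J := J1)) => // x; rewrite -q1E -J1E.
Qed.

Lemma corresponds_structures J0 J1 w0 w1 : corresponds J0 w0 -> corresponds J1 w1 ->
  (forall x, is_quaternionic (@J0 x)) -> (forall x, is_quaternionic (@J1 x)) ->
  whomotopic w0 w1 -> Jhomotopic J0 J1.
Proof.
move=> [q0 [h0 c0 s0 e0]] [q1 [h1 c1 s1 e1]] qJ0 qJ1 [w [nw cw w0E w1E]].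
have [g [hg cg g0 g1]] := metric_path h0 h1 c0 c1.
have [J [q [qJ cJ _ uJ]]] := polar_family hg cg nw cw.
exists J; split=> //; apply: uJ => // x; rewrite ?g0 ?g1 ?w0E ?w1E //.
Qed.

Lemma corresponds_exists_form J : compact [set: X] -> hausdorff_space X ->
  (forall x, is_quaternionic (@J x)) -> (forall T : topologicalType, Jcont (fun _ : T => J)) ->
  exists w : wmap, [/\ corresponds J w, forall x, is_nsform (@w x) &
    forall T : topologicalType, wcont (fun _ : T => w)].
Proof.
move=> cX hX qJ cJ; have [g [hg cg]] := herm_exists cX hX.
have [q [hq sq cq _]] := quat_avg_family (fun (_ : R) => hg) (cg R) (fun=> qJ) (cJ R).
have [w [we nw cw]] := form_of_family hq cq (fun=> qJ) (cJ R) sq.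
exists (w 0); split; [|exact: nw|].
  exists (q 0); split; [exact: hq| |exact: sq|exact: we].
  by move=> T; exact: (@fcont_const R X R T xi xi R _ 0 cq).
by move=> T; exact: (@fcont_const R X R T xi xi (vtot lambda) _ 0 cw).
Qed.

Lemma corresponds_exists_structure w : compact [set: X] -> hausdorff_space X ->
  (forall x, is_nsform (@w x)) -> (forall T : topologicalType, wcont (fun _ : T => w)) ->
  exists J : Jmap, [/\ corresponds J w, forall x, is_quaternionic (@J x) &
    forall T : topologicalType, Jcont (fun _ : T => J)].
Proof.
move=> cX hX nw cw; have [g [hg cg]] := herm_exists cX hX.
have [J [q [qJ cJ [hq cq sq we] _]]] :=
  polar_family (fun (_ : R) => hg) (cg R) (fun=> nw) (cw R).
exists (J 0); split; [|exact: qJ|].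
  exists (q 0); split; [exact: hq| |exact: sq|exact: we].
  by move=> T; exact: (@fcont_const R X R T xi xi R _ 0 cq).
by move=> T; exact: (@fcont_const R X R T lambda xi (vtot xi) _ 0 cJ).
Qed.

End Correspondence.

(** * Naturality and homotopy classes *)

Section PullbackMaps.
Variables (R : realType) (Y X : topologicalType) (f : Y -> X).

Lemma bmap_cvg (E' : vbundle R Y) (E : vbundle R X) (b : bmap f E' E)
    I (F : set_system I) (FF : Filter F) (y : I -> Y) (y0 : Y)
    (v : forall i, E' (y i)) (v0 : E' y0) :
  vcvg F v v0 -> vcvg F (fun i => b (y i) (v i)) (b y0 v0).
Proof.
move=> hv.
exact: (@total_cvg Y E' _ _ (@bm_continuous _ _ _ _ _ _ b) I F FF y v y0 v0 hv).
Qed.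

Arguments bmap_cvg {E' E} b {I F} FF {y y0 v v0}.

Variables (delta' : rline R Y) (lambda' : Cline delta') (xi' : Cbundle delta').
Variables (delta : rline R X) (lambda : Cline delta) (xi : Cbundle delta).
Variable m : data_map f lambda' xi' lambda xi.

Local Notation ml := (dm_lambda m _).
Local Notation mx := (dm_xi m _).
Local Notation md := (dm_delta m _).

Let mlD y : {morph dm_lambda m y : u v / u + v} :=
  linearDP (bm_linear (dm_lambda m) (y := y)).
Let mxD y : {morph dm_xi m y : u v / u + v} :=
  linearDP (bm_linear (dm_xi m) (y := y)).
Let ml_inj y : injective (dm_lambda m y) := bij_inj (bm_bij (dm_lambda m) y).

(** Since lambda' maps isometrically to lambda, inner products of the pulled
    back form are inner products on lambda; so its continuity follows from
    vcvg_ip. *)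
Lemma pullback_forms (T : topologicalType)
    (w : T -> forall x, xi x -> xi x -> lambda x) :
  (forall t x, is_nsform (w t x)) -> wcont w ->
  exists w' : T -> forall y, xi' y -> xi' y -> lambda' y,
    [/\ forall t y (u v : xi' y), ml (w' t y u v) = w t (f y) (mx u) (mx v),
        forall t y, is_nsform (w' t y) & wcont w'].
Proof.
move=> nw cw.
have [w' e] : exists w' : T -> forall y, xi' y -> xi' y -> lambda' y,
    forall t y (u v : xi' y), ml (w' t y u v) = w t (f y) (mx u) (mx v).
  apply: (@dchoice2 T Y (fun y => xi' y -> xi' y -> lambda' y)
    (fun t y h => forall u v, ml (h u v) = w t (f y) (mx u) (mx v))) => t y.
  have [g _ gK] := bm_bij (dm_lambda m) y.
  by exists (fun u v => g (w t (f y) (mx u) (mx v))) => u v; rewrite gK.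
exists w'; split=> //.
  move=> t y; have [wr wl ws wn] := nw t (f y); split.
  - move=> u; split=> [v v'|z v]; apply: ml_inj.
      by rewrite mlD !e mxD; have [-> _] := wr (mx u).
    by rewrite dm_lambda_act !e dm_xi_act; have [_ ->] := wr (mx u).
  - move=> u; split=> [v v'|z v]; apply: ml_inj.
      by rewrite mlD !e mxD; have [-> _] := wl (mx u).
    by rewrite dm_lambda_act !e dm_xi_act; have [_ ->] := wl (mx u).
  - move=> u v; apply: ml_inj.
    by rewrite (linearNP (bm_linear (dm_lambda m) (y := y))) !e ws.
  - move=> h [hD hC]; have [g mK gK] := bm_bij (dm_xi m) y.
    have [gd _ gdK] := bm_bij (dm_delta m) y.
    pose k (v : xi (f y)) : lambda (f y) := ml (h (g v)).
    have [|u [wu uu]] := wn k.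
      split=> [a b|z a]; rewrite /k.
        by rewrite -mlD -hD; congr (ml (h _)); apply: (can_inj mK); rewrite mxD !gK.
      have -> : g (cact z a) = cact ((z.1, gd z.2) : Calg delta' y) (g a).
        by apply: (can_inj mK); rewrite dm_xi_act !gK /= gdK; case: (z).
      by rewrite hC dm_lambda_act /= gdK; case: (z).
    exists (g u); split=> [|u' wu'].
      apply/funext => v; apply: ml_inj.
      by rewrite e gK wu /k mK.
    apply: (can_inj mK); rewrite gK; apply: uu; apply/funext => v.
    by rewrite -(gK v) -e wu' /k gK.
move=> I F FF t t0 y y0 u u0 v v0 ht hu hv; have hy := vcvg_base FF hu.
apply: (@vcvg_ip R Y T lambda' (fun _ x => ip (cl_ip lambda') (x := x)) _ _ I F FF t t0 y y0) => //.
- by move=> _ z; exact: cl_ipP.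
- exact: ip_fcont.
move=> z z0 hz; rewrite -(dm_lambda_ip m) e.
have -> : (fun i => ip (cl_ip lambda') (w' (t i) (y i) (u i) (v i)) (z i))
  = (fun i => ip (cl_ip lambda) (w (t i) (f (y i)) (mx (u i)) (mx (v i))) (ml (z i))).
  by apply/funext => i; rewrite -(dm_lambda_ip m) e.
have hu' := bmap_cvg (dm_xi m) FF hu; have hv' := bmap_cvg (dm_xi m) FF hv.
have hz' := bmap_cvg (dm_lambda m) FF hz.
have hw := cw _ F FF t t0 (f \o y) _ _ _ _ _ ht hu' hv'.
exact: (@ip_fcont _ _ _ (cl_ip lambda) T _ F FF t t0 (f \o y) _ _ _ _ _ ht hw hz').
Qed.

Lemma pullback_corresponds (J : Hstructure lambda xi) (J' : Hstructure lambda' xi')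
    (w : forall x, xi x -> xi x -> lambda x) (w' : forall y, xi' y -> xi' y -> lambda' y) :
  Hpullback m J J' ->
  (forall y (u v : xi' y), ml (w' y u v) = w (f y) (mx u) (mx v)) ->
  corresponds (jmap J) w -> corresponds (jmap J') w'.
Proof.
move=> HJ e [q [hq cq sq we]].
have mJ y (u : lambda' y) (v : xi' y) : mx (jmap J' u v) = jmap J (ml u) (mx v).
  by rewrite /jmap HJ /= (linear0P (bm_linear (dm_delta m) (y := y))).
have mdact y (d : delta' y) (v : xi' y) : mx (dact d v) = dact (md d) (mx v).
  by rewrite /dact dm_xi_act.
exists (fun y u v => q (f y) (mx u) (mx v)); split.
- move=> y; have [ig gd] := hq (f y); split.
    split=> [v a u u'|u v|u u0].
    + by rewrite (bm_linear (dm_xi m)) (ip_Dl ig) (ip_Zl ig).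
    + by rewrite (ip_sgC ig).
    + apply: (ip_gt0 ig); apply: contra_neq u0 => mu.
      apply: (bij_inj (bm_bij (dm_xi m) y)).
      by rewrite mu (linear0P (bm_linear (dm_xi m) (y := y))).
  by move=> d u v; rewrite !mdact gd.
- move=> T I F FF t t0 y y0 u u0 v v0 ht hu hv.
  exact: (cq T _ F FF t t0 (f \o y) _ _ _ _ _ ht (bmap_cvg (dm_xi m) FF hu)
    (bmap_cvg (dm_xi m) FF hv)).
- by move=> y u v v'; rewrite !mJ sq.
- by move=> y u v z; rewrite -(dm_lambda_ip m) e we mJ.
Qed.

End PullbackMaps.

Lemma class_ofP (T : Type) (r : T -> T -> Prop) (a b : T) :
  (forall x, r x x) -> (forall x y, r x y -> r y x) ->
  (forall x y z, r x y -> r y z -> r x z) ->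
  class_of r a = class_of r b <-> r a b.
Proof.
move=> refl sym trans; split=> [/(congr1 (@proj1_sig _ _)) /= e|ab].
  have : [set c | r b c] b by exact: refl.
  by rewrite -e.
apply: eq_exist; apply/seteqP; split=> c /=; first exact/trans/sym.
exact: trans.
Qed.

Lemma class_of_surj (T : Type) (r : T -> T -> Prop) (c : classes r) :
  exists a, c = class_of r a.
Proof.
by case: c => A h; have [a Aa] := h; exists a; apply: eq_exist.
Qed.

Section Classes.
Variables (R : realType) (X : topologicalType) (delta : rline R X).
Variables (lambda : Cline delta) (xi : Cbundle delta).

Lemma Hclass_ofP (H H' : Hstructure lambda xi) :
  class_of (@Hhomotopic _ _ _ _ _) H = class_of (@Hhomotopic _ _ _ _ _) H'
  <-> Hhomotopic H H'.
Proof.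
apply: class_ofP => [x|x y|x y z].
- apply/Hhomotopic_maps; exists (fun=> jmap x); split=> // [_ z|].
    exact: jmap_quaternionic.
  exact: jmap_cont1.
- by move=> /Hhomotopic_maps h; apply/Hhomotopic_maps; exact: vhomotopic_sym.
- move=> /Hhomotopic_maps h /Hhomotopic_maps h'; apply/Hhomotopic_maps.
  exact: vhomotopic_trans h h'.
Qed.

Lemma form_class_ofP (w w' : skewform lambda xi) :
  class_of (@form_homotopic _ _ _ _ _) w = class_of (@form_homotopic _ _ _ _ _) w'
  <-> form_homotopic w w'.
Proof.
apply: class_ofP => [x|x y|x y z].
- apply/form_homotopic_maps; exists (fun=> Defs.form x); split=> // [_ z|].
    exact: form_nsform.
  exact: form_cont1.
- by move=> /form_homotopic_maps h; apply/form_homotopic_maps; exact: vhomotopic_sym.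
- move=> /form_homotopic_maps h /form_homotopic_maps h'; apply/form_homotopic_maps.
  exact: vhomotopic_trans h h'.
Qed.

(** The value on a class is the class of a form corresponding to a
    representative. The characterization asks only for some form that
    corresponds to H itself, so it can be used with pulled back data. *)
Lemma correspondence_on_classes : compact [set: X] -> hausdorff_space X ->
  exists Phi : Hclasses lambda xi -> form_classes lambda xi,
    forall (H : Hstructure lambda xi) (w : skewform lambda xi),
      Phi (class_of (@Hhomotopic _ _ _ _ _) H) = class_of (@form_homotopic _ _ _ _ _) w
      <-> exists2 w0, corresponds (jmap H) w0 &
          vhomotopic (fun w : forall x, xi x -> xi x -> lambda x =>
            forall x, is_nsform (@w x)) w0 (Defs.form w).
Proof.
move=> cX hX.
have h (c : Hclasses lambda xi) : exists p : Hstructure lambda xi * skewform lambda xi,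
    c = class_of (@Hhomotopic _ _ _ _ _) p.1 /\ corresponds (jmap p.1) (Defs.form p.2).
  have [H cH] := class_of_surj c.
  have [w [cw nw kw]] := corresponds_exists_form cX hX
    (jmap_quaternionic H) (@jmap_cont1 _ _ _ _ _ H).
  by exists (H, form_build nw kw).
pose p c := projT1 (cid (h c)).
have pP c : c = class_of (@Hhomotopic _ _ _ _ _) (p c).1 /\
    corresponds (jmap (p c).1) (Defs.form (p c).2) by exact: projT2 (cid (h c)).
exists (fun c => class_of (@form_homotopic _ _ _ _ _) (p c).2) => H w.
have [e co] := pP (class_of (@Hhomotopic _ _ _ _ _) H).
set c := p _ in e co *.
have /Hhomotopic_maps ho : Hhomotopic c.1 H by apply/Hclass_ofP.
split=> [/form_class_ofP /form_homotopic_maps hw|[w0 cw0 hw0]].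
  have [w0 [cw0 _ _]] := corresponds_exists_form cX hX
    (jmap_quaternionic H) (@jmap_cont1 _ _ _ _ _ H).
  exists w0 => //; apply: vhomotopic_trans hw.
  exact: corresponds_forms cw0 co (vhomotopic_sym ho).
apply/form_class_ofP/form_homotopic_maps; apply: vhomotopic_trans hw0.
exact: corresponds_forms co cw0 ho.
Qed.

End Classes.

Theorem proposition5p3 (R : realType) :
  exists Phi : forall (X : topologicalType)
      (cX : compact [set: X]) (hX : hausdorff_space X)
      (delta : rline R X) (lambda : Cline delta) (xi : Cbundle delta),
      Hclasses lambda xi -> form_classes lambda xi,
    (forall (X : topologicalType)
        (cX : compact [set: X]) (hX : hausdorff_space X)
        (delta : rline R X) (lambda : Cline delta) (xi : Cbundle delta),
      bijective (Phi X cX hX delta lambda xi))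
    /\
    (forall (Y X : topologicalType)
        (cY : compact [set: Y]) (hY : hausdorff_space Y)
        (cX : compact [set: X]) (hX : hausdorff_space X)
        (delta' : rline R Y) (lambda' : Cline delta') (xi' : Cbundle delta')
        (delta : rline R X) (lambda : Cline delta) (xi : Cbundle delta)
        (f : Y -> X) (m : data_map f lambda' xi' lambda xi)
        (J : Hstructure lambda xi) (J' : Hstructure lambda' xi')
        (w : skewform lambda xi) (w' : skewform lambda' xi'),
      continuous f -> Hpullback m J J' -> form_pullback m w w' ->
      Phi X cX hX delta lambda xi (class_of (@Hhomotopic _ _ _ _ _) J)
        = class_of (@form_homotopic _ _ _ _ _) w ->
      Phi Y cY hY delta' lambda' xi' (class_of (@Hhomotopic _ _ _ _ _) J')
        = class_of (@form_homotopic _ _ _ _ _) w').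
Proof.
pose Phi X cX hX delta lambda xi :=
  projT1 (cid (@correspondence_on_classes R X delta lambda xi cX hX)).
have PhiP X cX hX delta lambda xi :=
  projT2 (cid (@correspondence_on_classes R X delta lambda xi cX hX)).
exists Phi; split.
  move=> X cX hX delta lambda xi.
  have P := PhiP X cX hX delta lambda xi.
  pose F := Phi X cX hX delta lambda xi; rewrite -/F.
  have inj : injective F.
    move=> c c'; have [H ->] := class_of_surj c; have [H' ->] := class_of_surj c'.
    have [w we] := class_of_surj (F (class_of (@Hhomotopic _ _ _ _ _) H')).
    rewrite we => /P [w0 cw0 hw0]; move/P: we => [w1 cw1 hw1].
    apply/Hclass_ofP/Hhomotopic_maps.
    apply: (corresponds_structures cw0 cw1); [exact: jmap_quaternionic | exact: jmap_quaternionic |].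
    exact: vhomotopic_trans hw0 (vhomotopic_sym hw1).
  have surj c : exists a, F a = c.
    have [w ->] := class_of_surj c.
    have [J [cJ qJ kJ]] := corresponds_exists_structure cX hX
      (form_nsform w) (@form_cont1 _ _ _ _ _ w).
    exists (class_of (@Hhomotopic _ _ _ _ _) (Hbuild qJ kJ)); apply/P.
    exists (Defs.form w).
      have -> : jmap (Hbuild qJ kJ) = J; last by [].
      apply: functional_extensionality_dep => x; apply/funext => u; apply/funext => v.
      exact: jmap_build.
    apply/form_homotopic_maps; exact/form_class_ofP.
  exists (fun c => projT1 (cid (surj c))) => c; last exact: projT2 (cid (surj c)).
  by apply: inj; exact: projT2 (cid (surj _)).
move=> Y X cY hY cX hX delta' lambda' xi' delta lambda xi f m J J' w w' _ HJ Hw.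
move=> /(PhiP X cX hX delta lambda xi) [w0 cw0 [W [nW cW W0 W1]]].
have [W' [e nW' cW']] := pullback_forms m nW cW.
apply/(PhiP Y cY hY delta' lambda' xi'); exists (W' 0).
  by apply: (pullback_corresponds HJ _ cw0) => y u v; rewrite e W0.
exists W'; split=> //.
apply: functional_extensionality_dep => y; apply/funext => u; apply/funext => v.
apply: (bij_inj (bm_bij (dm_lambda m) y)).
by rewrite e W1 Hw.
Qed.
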